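(* For any $K=(k_1,\ldots,k_s)\vdash d'$, we have $$\widetilde{W}_{d,m}(K;\beta)=a_{d',K}\,\widetilde{W}_{d,m}(\theta_{d',d'};\beta)+a_{d'-1,K}\,\widetilde{W}_{d,m}(\theta_{d'-1,d'};\beta)+\cdots+a_{1,K}\,\widetilde{W}_{d,m}(\theta_{1,d'};\beta),$$ $$\widetilde{H}_{d,m}(K;\beta)=a_{d',K}\,\widetilde{H}_{d,m}(\theta_{d',d'};\beta)+a_{d'-1,K}\,\widetilde{H}_{d,m}(\theta_{d'-1,d'};\beta)+\cdots+a_{1,K}\,\widetilde{H}_{d,m}(\theta_{1,d'};\beta).$$
   Context: Here $d\ge1$, $1\le m\le d$ and $\beta\vdash d$. $\theta_{i,d'}=[1^{d'-i},i]\vdash d'$ is the partition with one part $i$ and $d'-i$ further parts equal to 1 (so $\theta_{1,d'}=[1^{d'}]$); as a first argument it denotes the corresponding tuple of orders of completed cycles. For $K=(k_1,\ldots,k_s)\vdash d'$ put $\rho(K)=\prod_{i=1}^s(x^{k_i}-y^{k_i})$. The polynomials $\rho(\theta_{1,d'}),\ldots,\rho(\theta_{d',d'})$ form a basis of the space of homogeneous polynomials $\sum_{i=0}^{d'}c_ix^iy^{d'-i}$ with $\sum_i c_i=0$, which contains $\rho(K)$; $a_{i,K}$ are the unique coefficients with $\rho(K)=\sum_{i=1}^{d'}a_{i,K}\rho(\theta_{i,d'})$. Normalizations: $\widetilde H_{d,m}(K;\beta)=H_{d,m}(k_1,\ldots,k_s;(d),\beta)\prod_{i=1}^sk_i!$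 and $\widetilde W_{d,m}(K;\beta)=\overline W_{d,m}(k_1,\ldots,k_s;(d),\beta)\prod_{i=1}^sk_i!$, with $H_{d,m}$ and $\overline W_{d,m}$ as follows. $\mathcal{C}_\lambda$ is the conjugacy class of cycle type $\lambda$ in the symmetric group $\mathfrak{S}_{|\lambda|}$, $\chi^\lambda$ the irreducible character indexed by $\lambda$, $\chi^\lambda_\mu$ its value on $\mathcal{C}_\mu$, $\dim(\lambda)$ its degree, $\ell(\lambda)$ the number of parts of $\lambda$. For $k\ge1$ let $p_k(\lambda)=\sum_{i\ge1}\big[(\lambda_i-i+\tfrac12)^k-(-i+\tfrac12)^k\big]$. Let $f_\eta(\mu)=\binom{|\mu|}{|\eta|}|\mathcal{C}_\eta|\chi^\mu_\eta/\dim(\mu)$, where $f_\eta(\mu)=0$ if $|\mu|<|\eta|$, where for $|\mu|>|\eta|$ the value $\chi^\mu_\eta$ is taken at an element of cycle type $\eta$ of the subgroup $\mathfrak{S}_{|\eta|}$ of $\mathfrak{S}_{|\mu|}$, and $f_\varnothing=1$. The $f_\eta$ form a basis of the algebra of shifted symmetric functions; write $p_k=\sum_\eta\kappa_{k,\eta}f_\eta$. For $|\eta|\le d$ let $\eta^{\uparrow d}\vdash d$ be $\eta$ with $d-|\eta|$ parts equal to 1 added. For $\mu^1,\ldots,\mu^r\vdash d$, $$H_d(k_1,\ldots,k_s;\mu^1,\ldots,\mu^r)=\frac1{d!}\sum_{\eta_1,\ldots,\eta_s,\ |\eta_i|\le d}\ \Big(\prod_{i=1}^s\frac{\kappa_{k_i,\eta_i}}{k_i!}\Big)N,$$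 where the $\eta_i$ are partitions and $N$ is the number of tuples $(\sigma_1,\ldots,\sigma_s,\pi_1,\ldots,\pi_r)$ in $\mathfrak{S}_d$ with $\sigma_1\cdots\sigma_s\pi_1\cdots\pi_r=1$, $\sigma_i$ of cycle type $\eta_i^{\uparrow d}$, $\pi_j$ of cycle type $\mu^j$. Then $H_{d,m}(k_1,\ldots,k_s;\mu^1,\ldots,\mu^r)=\sum_{\mu^{r+1}\vdash d,\ \ell(\mu^{r+1})=m}H_d(k_1,\ldots,k_s;\mu^1,\ldots,\mu^{r+1})$, and $$\overline{W}_{d,m}(k_1,\ldots,k_s;\mu^1,\ldots,\mu^r)=\frac1{d!\,m!}\sum_{\lambda\vdash d}\mathfrak{c}_{\lambda,m}\frac{\prod_{i=1}^r|\mathcal{C}_{\mu^i}|\chi^\lambda_{\mu^i}}{\dim(\lambda)^{r-1}}\prod_{i=1}^s\frac{p_{k_i}(\lambda)}{k_i!},\qquad \mathfrak{c}_{\lambda,m}=\sum_{k=0}^m(-1)^k\binom mk\prod_{u\in\lambda}\frac{m-k+c(u)}{h(u)},$$ where for a cell $u=(i,j)$ of the Young diagram of $\lambda$, $c(u)=j-i$ and $h(u)$ is its hook length.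
   Formalization: In H_d each η_i is also weighted by binom(m_1(η_i^{↑d}), m_1(η_i)), m_1 = number of parts 1, so that it acts by f_{η_i}; without this weight the H identity fails, e.g. d=m=3, β=(1,1,1), K=(2,2): 4 versus 4/3. *)

(* Defs.v *)
From HB Require Import structures.
From mathcomp Require Import all_boot all_order all_algebra all_fingroup.
From mathcomp Require Import all_solvable all_field all_character.
From mathcomp Require Import mpoly.

Set Implicit Arguments.
Unset Strict Implicit.
Unset Printing Implicit Defensive.

Import GRing.Theory.
Local Open Scope ring_scope.

(** * Integer partitions *)

Definition is_part (n : nat) (s : seq nat) : bool :=
  [&& sorted geq s, 0%N \notin s & sumn s == n].

Record intpart (n : nat) := IntPart { parts :> seq nat; _ : is_part n parts }.

HB.instance Definition _ n := [isSub for @parts n].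
HB.instance Definition _ n := [Countable of intpart n by <:].

Section IntpartFinite.
Variable n : nat.

Lemma size_sumn_pos (s : seq nat) : 0%N \notin s -> (size s <= sumn s)%N.
Proof.
elim: s => //= -[|k] s IHs; first by rewrite inE eqxx.
rewrite inE negb_or => /andP[_ /IHs le_s]; rewrite addSn ltnS.
exact: leq_trans le_s (leq_addl _ _).
Qed.

Lemma nth_sumn_le (s : seq nat) i : (nth 0 s i <= sumn s)%N.
Proof.
elim: s i => [|k s IHs] [|i] //=; first exact: leq_addr.
exact: leq_trans (IHs i) (leq_addl _ _).
Qed.

Definition intpart_enc (p : intpart n) : {ffun 'I_n -> 'I_n.+1} :=
  [ffun i : 'I_n => inord (nth 0%N (parts p) i)].

Definition intpart_dec (f : {ffun 'I_n -> 'I_n.+1}) : option (intpart n) :=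
  insub [seq k <- [seq val (f i) | i <- enum 'I_n] | k != 0%N].

Lemma intpart_encK : pcancel intpart_enc intpart_dec.
Proof.
case=> s s_part; have /and3P[_ s_pos /eqP s_sum] := s_part.
rewrite /intpart_dec.
suff -> : [seq k <- [seq val (intpart_enc (IntPart s_part) i) | i <- enum 'I_n]
             | k != 0%N] = s.
  by rewrite insubT.
have -> : [seq val (intpart_enc (IntPart s_part) i) | i <- enum 'I_n]
           = [seq nth 0%N s i | i <- iota 0 n].
  rewrite -val_enum_ord -map_comp; apply: eq_map => i /=.
  by rewrite ffunE /= inordK // ltnS -{2}s_sum nth_sumn_le.
have le_sn : (size s <= n)%N by rewrite -s_sum size_sumn_pos.
rewrite -(subnKC le_sn) iotaD map_cat filter_cat add0n.
rewrite (_ : map _ (iota 0 _) = s); last first.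
  by rewrite -[RHS](mkseq_nth 0%N).
rewrite (@eq_in_filter _ _ predT) => [|k k_s]; last first.
  by apply: contraNneq s_pos => <-.
rewrite filter_predT (@eq_in_filter _ _ pred0) => [|k].
  by rewrite filter_pred0 cats0.
case/mapP=> i; rewrite mem_iota => /andP[le_si _] ->.
by rewrite nth_default.
Qed.

HB.instance Definition _ :=
  isFinite.Build (intpart n) (pcan_enumP intpart_encK).

End IntpartFinite.

(** * Conjugacy classes and irreducible characters of symmetric groups *)

Definition cycle_type (n : nat) (s : 'S_n) : seq nat :=
  sort geq [seq #|X| | X : {set 'I_n} in porbits s].

Definition cclass (n : nat) (mu : seq nat) : {set 'S_n} :=
  [set s : 'S_n | cycle_type s == mu].

(* [eta] with [n - |eta|] parts equal to 1 added. *)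
Definition up (n : nat) (eta : seq nat) : seq nat :=
  eta ++ nseq (n - sumn eta)%N 1%N.

Lemma stab_group_set (n : nat) (T : eqType) (f : 'I_n -> T) :
  group_set [set s : 'S_n | [forall k, f (s k) == f k]].
Proof.
apply/group_setP; split=> [|s t]; first by rewrite inE; apply/forallP => k; rewrite perm1.
rewrite !inE => /forallP fs /forallP ft; apply/forallP => k.
by rewrite permM (eqP (ft _)) (eqP (fs _)).
Qed.
Canonical stab_group n T f := Group (@stab_group_set n T f).

(* The row and column stabilisers of the tableau of shape [la] whose cells are
   numbered row by row: [reshape_index la k] and [reshape_offset la k] are the
   row and the column of the cell numbered [k]. *)
Definition row_stab n (la : intpart n) : {group 'S_n} :=
  stab_group (fun k : 'I_n => reshape_index la k).
Definition col_stab n (la : intpart n) : {group 'S_n} :=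
  stab_group (fun k : 'I_n => reshape_offset la k).

Lemma sgn_class_fun (n : nat) (G : {group 'S_n}) :
  is_class_fun <<G>>%g [ffun s : 'S_n => if s \in G then (-1) ^+ s else 0 : algC].
Proof.
rewrite genGid; apply: intro_class_fun => [s t Gs Gt | s /negbTE -> //].
by rewrite groupJ // Gs odd_permJ.
Qed.
Definition cf_sgn n (G : {group 'S_n}) : 'CF(G) := Cfun 0 (sgn_class_fun G).

(* The irreducible character indexed by [la], labelled as usual (James-Kerber):
   the only common irreducible constituent of the characters induced from the
   trivial character of the row stabiliser and from the sign character of the
   column stabiliser; thus [n] labels the trivial character. *)
Definition irr_sym n (la : intpart n) : 'CF([set: 'S_n]) :=
  'chi_(odflt 0 [pick i : Iirr [set: 'S_n] |
     (i \in irr_constt ('Ind[[set: 'S_n], row_stab la] 1))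
     && (i \in irr_constt ('Ind[[set: 'S_n], col_stab la] (cf_sgn _)))]).

Definition irr_val n (la : intpart n) (mu : seq nat) : algC :=
  irr_sym la (repr (cclass n mu)).

Definition irr_dim n (la : intpart n) : algC := irr_sym la 1%g.

(** * Shifted symmetric functions *)

(* Rows are numbered from 0; the terms with [i >= size la] vanish. *)
Definition shifted_p (k : nat) (la : seq nat) : algC :=
  \sum_(i < size la)
     (((nth 0%N la i)%:R - i.+1%:R + 2^-1) ^+ k - (- (i.+1%:R) + 2^-1) ^+ k).

(* The binomial coefficient makes this 0 when [n < j]. *)
Definition shifted_f (j n : nat) (eta : intpart j) (mu : intpart n) : algC :=
  'C(n, j)%:R * #|cclass j eta|%:R * irr_val mu (up n eta) / irr_dim mu.

(* [kappa k _ eta] is the coordinate of [shifted_p k] on [shifted_f eta]; by the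
   Kerov-Olshanski theorem there is exactly one such [kappa] (for [k > 0]). *)
Definition shifted_coords (kappa : nat -> forall j, intpart j -> algC) : Prop :=
  forall k, (0 < k)%N -> exists N : nat,
    (forall j (eta : intpart j), (N < j)%N -> kappa k j eta = 0) /\
    (forall n (la : intpart n),
       shifted_p k la
       = \sum_(j < N.+1) \sum_(eta : intpart j) kappa k j eta * shifted_f eta la).

(** * Hurwitz numbers with completed cycles *)

(* Number of tuples of permutations with product 1 and given cycle types. *)
Definition num_factor (d : nat) (ts : seq (seq nat)) : nat :=
  #|[set t : (size ts).-tuple 'S_d
      | ((\prod_(s <- t) s)%g == 1%g) && (map (@cycle_type d) t == ts)]|.

(* Number of ways to choose, among the parts 1 of [up d eta], those of [eta]:
   the usual multiplicity of a ramification profile [eta] of size less than [d].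
   With it the class sum of [up d eta] acts on the representation [la] of 'S_d by
   [shifted_f eta la]. Without it the linear relations between the [H_tilde] fail:
   for d = m = 3, beta = (1,1,1), K = (2,2) one has
   rho K = 4/3 rho (3,1) - 1/3 rho (1,1,1,1), but the three unweighted values of
   [H_tilde] are 4, 1 and 0. *)
Definition up_mult (d : nat) (eta : seq nat) : nat :=
  'C(count_mem 1%N (up d eta), count_mem 1%N eta).

(* The [eta_i] range over the partitions of size at most [d]. *)
Definition Hd (kappa : nat -> forall j, intpart j -> algC) (d : nat)
    (ks : seq nat) (mus : seq (seq nat)) : algC :=
  d`!%:R^-1 *
  \sum_(eta : {ffun 'I_(size ks) -> {j : 'I_d.+1 & intpart j}})
     (\prod_(i < size ks)
         (kappa (nth 0%N ks i) _ (tagged (eta i)) / (nth 0%N ks i)`!%:R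
          * (up_mult d (tagged (eta i)))%:R))
     * (num_factor d
          ([seq up d (tagged (eta i)) | i <- enum 'I_(size ks)] ++ mus))%:R.

Definition Hdm (kappa : nat -> forall j, intpart j -> algC) (d m : nat)
    (ks : seq nat) (mus : seq (seq nat)) : algC :=
  \sum_(mu : intpart d | size mu == m) Hd kappa d ks (rcons mus mu).

Definition hook (la : seq nat) (i j : nat) : nat :=
  ((nth 0 la i - j.+1) + (count (fun r => j < r) la - i.+1)).+1%N.

Definition c_coef (la : seq nat) (m : nat) : algC :=
  \sum_(k < m.+1) (-1) ^+ k * 'C(m, k)%:R *
    \prod_(i < size la) \prod_(j < nth 0%N la i)
       (((m - k)%N%:R + (j%:R - i%:R)) / (hook la i j)%:R).

Definition Wdm (d m : nat) (ks : seq nat) (mus : seq (seq nat)) : algC :=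
  (d`!%:R * m`!%:R)^-1 *
  \sum_(la : intpart d)
     c_coef la m
     * ((\prod_(mu <- mus) (#|cclass d mu|%:R * irr_val la mu))
        / irr_dim la ^ ((size mus)%:Z - 1))
     * \prod_(k <- ks) (shifted_p k la / k`!%:R).

Definition H_tilde (kappa : nat -> forall j, intpart j -> algC) (d m : nat)
    (K beta : seq nat) : algC :=
  Hdm kappa d m K [:: [:: d]; beta] * \prod_(k <- K) k`!%:R.

Definition W_tilde (d m : nat) (K beta : seq nat) : algC :=
  Wdm d m K [:: [:: d]; beta] * \prod_(k <- K) k`!%:R.

(** * The polynomials rho *)

Definition theta (i d : nat) : seq nat := i :: nseq (d - i)%N 1%N.

(* [x] is ['X_0] and [y] is ['X_1]. *)
Definition rho (K : seq nat) : {mpoly algC[2]} :=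
  \prod_(k <- K) ('X_0 ^+ k - 'X_1 ^+ k).

(* Main.v *)
Require Import Defs.
From mathcomp Require Import all_boot all_order all_algebra all_fingroup.
From mathcomp Require Import all_solvable all_field all_character.
From mathcomp Require Import mpoly.

Set Implicit Arguments.
Unset Strict Implicit.
Unset Printing Implicit Defensive.

Import Order.TTheory GRing.Theory Num.Theory.
Local Open Scope ring_scope.

(** On a hook [la = (d - b, 1^b)] the sum defining [shifted_p k la] telescopes to
    [x ^+ k - y ^+ k] with [x = d - b - 1/2] and [y = - b - 1/2]. The product of the
    [shifted_p k la] over the parts [k] of [K] is therefore the value of [rho K] at
    [(x, y)], and depends linearly on [rho K] (lemma [theta_linear_prod]). The two
    identities follow once both sides are written as linear combinations of such
    products over hooks only; this is possible because one of the ramification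
    profiles is [(d)] and only the hooks have a character that does not vanish at
    a full cycle.

    For [W_tilde] this is read off its definition. For [H_tilde], Frobenius' formula
    [num_factorE] turns the count of factorizations into a sum over the
    irreducible characters of products of central characters. The multiplicity
    [up_mult] is what makes the class sum of [up d eta] act as [shifted_f eta la]
    ([up_mult_cclass]), so the sum over [eta] with coefficients [kappa k] acts as
    [shifted_p k la] ([completed_omegaE]).

    It remains to see why the irreducible characters that do not vanish at a full
    cycle are those labelled by the hooks ([irr_sym_full_cycle] and
    [full_cycle_irr_sym]). Give a subset [J] stable under a permutation [s] the
    weight (-1) to the number of orbits of [s] in [J]. Toggling one orbit changes
    the sign, so the weights over all [J] add up to 0, and those over the [J] that
    avoid a given point add up to 1 if [s] is a full cycle and to 0 otherwise.
    Up to a nonzero factor, pairing the weight of [J] with an irreducible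
    character chi gives the multiplicity of chi in the character induced from
    the stabiliser of [J], trivial on the permutations of the complement of [J]
    and equal to the sign on those of [J]; it depends only on the size of [J].
    Hence, if chi does not vanish at a full cycle, it occurs for two different
    sizes. If it occurs for [J] and for [J'], then chi is a common constituent of
    the trivial character induced from the symmetric group of the complement of
    [J] and of the sign induced from that of [J'].

    A Mackey type computation ([cfdot_Ind_stab]) shows that two characters induced
    in this way from the stabilisers of functions [f] and [g] have a common
    constituent exactly when some translate of the fibres of [f] meets every fibre
    of [g] at most once. This has three consequences. The two sizes above are
    consecutive, say [b] and [b + 1], so that chi is a common constituent for the
    rows and columns of the hook [(d - b, 1^b)]. For a hook there is only one such
    constituent ([hook_common_constt_uniq]), so that chi is the character
    labelled by that hook. And if chi is also labelled by [la], then [la] has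
    first part at least [d - b] and at least [b + 1] parts, which makes it the same
    hook ([intpart_hook]). *)

(** * Cycle types and conjugacy *)

Section CycleTypes.
Variable n : nat.
Implicit Types s t x : 'S_n.

Lemma expperm_porbit_mod s k i :
  (s ^+ (i %% #|porbit s k|))%g k = (s ^+ i)%g k.
Proof.
rewrite {2}(divn_eq i #|porbit s k|) addnC expgD permM mulnC expgM.
set c := #|porbit s k|; have sc y: (y \in porbit s k) -> (s ^+ c)%g y = y.
  by rewrite -eq_porbit_mem => /eqP Py; rewrite permX /c -Py iter_porbit.
elim: (i %/ c)%N => [|m IHm]; first by rewrite expg0 perm1.
by rewrite expgSr permM -IHm sc ?mem_porbit.
Qed.

Lemma eq_expperm_mod s k i j :
  ((s ^+ i)%g k == (s ^+ j)%g k) = (i == j %[mod #|porbit s k|]).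
Proof.
have c_gt0: (0 < #|porbit s k|)%N by rewrite lt0n card_porbit_neq0.
rewrite -(expperm_porbit_mod s k i) -(expperm_porbit_mod s k j).
have lt_mod l: (l %% #|porbit s k| < #|porbit s k|)%N by rewrite ltn_mod.
rewrite !permX -!(@nth_traject _ s _ #|porbit s k|) ?lt_mod //.
by rewrite nth_uniq ?size_traject ?lt_mod ?uniq_traject_porbit.
Qed.

Lemma porbit_conj s x k : porbit (s ^ x)%g (x k) = x @: porbit s k.
Proof.
apply/setP=> y; apply/porbitP/imsetP=> [[i ->] | [z /porbitP[i ->] ->]].
  exists ((s ^+ i)%g k); first exact: mem_porbit.
  by rewrite -conjXg /conjg !permM permK.
by exists i; rewrite -conjXg /conjg !permM permK.
Qed.

Lemma porbits_conj s x :
  porbits (s ^ x)%g = [set x @: (X : {set 'I_n}) | X in porbits s].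
Proof.
apply/setP=> Y; apply/imsetP/imsetP=> [[k _ ->] | [X /imsetP[k _ ->] ->]].
  by exists (porbit s ((x^-1)%g k)); rewrite ?imset_f // -porbit_conj permKV.
by exists (x k); rewrite ?porbit_conj.
Qed.

Lemma cycle_typeJ s x : cycle_type (s ^ x)%g = cycle_type s.
Proof.
apply/perm_sortP.
- by move=> a b; apply: leq_total.
- by move=> a b c ba cb; apply: leq_trans cb ba.
- by move=> a b /anti_leq.
have inj_im: injective (fun X : {set 'I_n} => x @: X).
  by apply: imset_inj; apply: perm_inj.
suffices: perm_eq (enum (porbits (s ^ x)%g))
   [seq x @: (X : {set 'I_n}) | X <- enum (porbits s)].
  move/(perm_map (fun X : {set 'I_n} => #|X|))/perm_trans; apply.
  rewrite -map_comp (@eq_map _ _ _ (fun X : {set 'I_n} => #|X|)) // => X /=.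
  by rewrite card_imset //; apply: perm_inj.
apply: uniq_perm; rewrite ?enum_uniq ?map_inj_uniq ?enum_uniq // => Y.
rewrite mem_enum porbits_conj; apply/imsetP/mapP=> -[X X_s ->]; exists X => //.
  by rewrite mem_enum.
by rewrite mem_enum in X_s.
Qed.

(** Two permutations with the same cycle lengths: match the orbits by decreasing
    size, pick a base point in each, and send the [i]-th iterate of a base point
    to the [i]-th iterate of the matching one. *)
Lemma cycle_type_conj s t :
  cycle_type s = cycle_type t -> exists x, t = (s ^ x)%g.
Proof.
pose L u := sort (relpre (fun X : {set 'I_n} => #|X|) geq) (enum (porbits u)).
have L_type u : [seq #|X| | X : {set 'I_n} <- L u] = cycle_type u.
  by rewrite /cycle_type sort_map.
have L_uniq u : uniq (L u) by rewrite sort_uniq enum_uniq.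
have memL u X : (X \in L u) = (X \in porbits u) by rewrite mem_sort mem_enum.
move=> eq_st; have eq_size: size (L s) = size (L t).
  by rewrite -(size_map (fun X : {set 'I_n} => #|X|)) L_type eq_st -L_type size_map.
pose h X := nth set0 (L t) (index X (L s)).
have hP k : h (porbit s k) \in porbits t.
  by rewrite -memL mem_nth // -eq_size index_mem memL imset_f.
have h_inj k l : h (porbit s k) = h (porbit s l) -> porbit s k = porbit s l.
  move=> /eqP; rewrite nth_uniq // -?eq_size ?index_mem ?memL ?imset_f //.
  by move=> /eqP /(congr1 (nth set0 (L s))); rewrite !nth_index ?memL ?imset_f.
have h_card k : #|h (porbit s k)| = #|porbit s k|.
  have k_s: porbit s k \in L s by rewrite memL imset_f.
  have lt_k: (index (porbit s k) (L s) < size (L s))%N by rewrite index_mem.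
  rewrite -{2}(nth_index set0 k_s).
  rewrite -(nth_map set0 0%N (fun X : {set 'I_n} => #|X|)) -?eq_size //.
  rewrite -(nth_map set0 0%N (fun X : {set 'I_n} => #|X|)) //.
  by rewrite !L_type eq_st.
(* [b k X] is a base point of the orbit [X]; [k] is a default value only. *)
pose b (k : 'I_n) (X : {set 'I_n}) := odflt k [pick y in X].
have bP k u X : X \in porbits u -> porbit u (b k X) = X.
  case/imsetP=> l _ ->; rewrite /b; case: pickP => [y | /(_ l)] /=.
    by rewrite -eq_porbit_mem => /eqP.
  by rewrite porbit_id.
have b_def k l u X : X \in porbits u -> b k X = b l X.
  case/imsetP=> y _ ->; rewrite /b; case: pickP => [// | /(_ y)].
  by rewrite porbit_id.
pose ix k := index k (traject s (b k (porbit s k)) #|porbit s k|).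
have ixP k : (s ^+ ix k)%g (b k (porbit s k)) = k.
  have k_b: k \in porbit s (b k (porbit s k)) by rewrite bP ?imset_f // porbit_id.
  have c_b: #|porbit s (b k (porbit s k))| = #|porbit s k| by rewrite bP ?imset_f.
  rewrite porbit_traject c_b in k_b.
  rewrite permX -(@nth_traject _ s _ #|porbit s k|).
    by rewrite nth_index.
  by rewrite -[X in (_ < X)%N](size_traject s (b k (porbit s k))) index_mem.
pose f k := (t ^+ ix k)%g (b k (h (porbit s k))).
have f_orb k : porbit t (f k) = h (porbit s k) by rewrite porbit_perm bP.
have f_s k : f (s k) = t (f k).
  have Psk: porbit s (s k) = porbit s k by have:= porbit_perm s 1 k; rewrite expg1.
  rewrite /f Psk (b_def (s k) k t) //.
  rewrite -permM -expgSr; apply/eqP; rewrite eq_expperm_mod bP // h_card.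
  rewrite -(@bP k s (porbit s k)) ?imset_f // -eq_expperm_mod expgSr permM ixP.
  by rewrite -[X in b k X]Psk (b_def k (s k) s) ?imset_f // ixP.
have f_inj: injective f.
  move=> k l eq_kl; have := f_orb k; rewrite eq_kl f_orb => /h_inj/esym eqP_kl.
  move/eqP: eq_kl; rewrite /f eqP_kl (b_def k l t) // eq_expperm_mod bP // h_card.
  rewrite -(@bP l s (porbit s l)) ?imset_f // -eq_expperm_mod ixP => /eqP eq_l.
  by rewrite -[k]ixP eqP_kl (b_def k l s) ?imset_f // eq_l.
exists (perm f_inj); apply/permP=> k.
rewrite -[k](permKV (perm f_inj)) /conjg !permM permK.
by rewrite !permE f_s.
Qed.

Lemma cclassJ mu s x : ((s ^ x)%g \in cclass n mu) = (s \in cclass n mu).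
Proof. by rewrite !inE cycle_typeJ. Qed.

End CycleTypes.

(** * Sizes of conjugacy classes *)

Section FixedPoints.

Lemma geq_trans : transitive geq.
Proof. by move=> a b c ba cb; apply: leq_trans cb ba. Qed.

Lemma perm_geq_sort (a b : seq nat) :
  reflect (sort geq a = sort geq b) (perm_eq a b).
Proof.
apply: perm_sortP; [by move=> k l; apply: leq_total | exact: geq_trans |].
by move=> k l /anti_leq.
Qed.

Lemma mem_cclass n (s : 'S_n) mu :
  sorted geq mu -> (s \in cclass n mu) = perm_eq (cycle_type s) mu.
Proof.
move=> mu_sorted; rewrite inE; apply/eqP/idP=> [-> // | /perm_geq_sort].
rewrite !(sorted_sort geq_trans) //.
by apply: sort_sorted => a b; apply: leq_total.
Qed.

(** The fixed points correspond to the orbits of size 1 through [porbit s]. *)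
Lemma count1_cycle_type n (s : 'S_n) :
  count_mem 1%N (cycle_type s) = #|[set k | s k == k]|.
Proof.
rewrite /cycle_type (seq.permP (permEl (perm_sort _ _))) count_map.
have inj1: {in [set k | s k == k] &, injective (porbit s)}.
  move=> k l; rewrite !inE => /eqP sk /eqP sl eq_kl.
  have: k \in porbit s l by rewrite -eq_kl porbit_id.
  case/porbitP=> i ->; elim: i => [|i IHi]; first by rewrite perm1.
  by rewrite expgSr permM IHi.
rewrite -(card_in_imset inj1) cardE -size_filter.
apply: perm_size; apply: uniq_perm.
- exact: filter_uniq (enum_uniq _).
- exact: enum_uniq.
move=> X; rewrite mem_filter !mem_enum /=; apply/andP/imsetP=> [[X1] | [k]].
  case/imsetP=> k _ def_X; exists k => //; rewrite inE; move: X1.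
  rewrite def_X => /cards1P[y def_y].
  have: k \in porbit s k by exact: porbit_id.
  have: s k \in porbit s k by have:= mem_porbit s 1 k; rewrite expg1.
  by rewrite def_y !inE => /eqP-> /eqP->.
rewrite inE => /eqP sk ->; split; last exact: imset_f.
rewrite (_ : porbit s k = [set k]) ?cards1 //; apply/setP=> y; rewrite inE.
apply/porbitP/eqP=> [[i ->] | ->]; last by exists 0%N; rewrite perm1.
by elim: i => [|i IHi]; rewrite ?perm1 // expgSr permM IHi.
Qed.

Lemma porbit_lift n (k : 'I_n.+1) (s : 'S_n) (l : 'I_n) :
  porbit (lift_perm k k s) (lift k l) = lift k @: porbit s l.
Proof.
have E i: (lift_perm k k s ^+ i)%g (lift k l) = lift k ((s ^+ i)%g l).
  elim: i => [|i IHi]; first by rewrite !perm1.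
  by rewrite !expgSr !permM IHi lift_perm_lift.
apply/setP=> y; apply/porbitP/imsetP=> [[i ->] | [z /porbitP[i ->] ->]].
  by exists ((s ^+ i)%g l); rewrite ?mem_porbit ?E.
by exists i; rewrite E.
Qed.

Lemma porbit_lift_id n (k : 'I_n.+1) (s : 'S_n) :
  porbit (lift_perm k k s) k = [set k].
Proof.
apply/setP=> y; rewrite inE.
apply/porbitP/eqP=> [[i ->] | ->]; last by exists 0%N; rewrite perm1.
by elim: i => [|i IHi]; rewrite ?perm1 // expgSr permM IHi lift_perm_id.
Qed.

Lemma cycle_type_lift n (k : 'I_n.+1) (s : 'S_n) :
  perm_eq (cycle_type (lift_perm k k s)) (1%N :: cycle_type s).
Proof.
rewrite /cycle_type perm_sort.
suffices P: perm_eq (enum (porbits (lift_perm k k s)))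
    ([set k] :: [seq lift k @: (X : {set 'I_n}) | X <- enum (porbits s)]).
  apply: perm_trans (perm_map _ P) _; rewrite /= cards1 perm_cons -map_comp.
  rewrite perm_sym perm_sort perm_sym.
  rewrite (@eq_map _ _ _ (fun X : {set 'I_n} => #|X|)) // => X /=.
  by rewrite card_imset //; apply: lift_inj.
apply: uniq_perm; rewrite ?enum_uniq //=.
  apply/andP; split; last first.
    by rewrite map_inj_uniq ?enum_uniq //; apply/imset_inj/lift_inj.
  apply/mapP=> -[X _] /setP/(_ k); rewrite inE eqxx => /esym/imsetP[l _].
  by move/eqP; rewrite (negPf (neq_lift _ _)).
move=> Y; rewrite mem_enum in_cons; apply/imsetP/idP=> [[l _ ->] | ].
  case: (unliftP k l) => [j ->|->]; last by rewrite porbit_lift_id eqxx.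
  by rewrite porbit_lift map_f ?orbT // mem_enum imset_f.
case/predU1P=> [->|/mapP[X]]; first by exists k; rewrite ?porbit_lift_id.
by rewrite mem_enum => /imsetP[l _ ->] ->; exists (lift k l); rewrite ?porbit_lift.
Qed.

Section Up.
Variables (j : nat) (eta : intpart j).

Lemma intpart_sum : sumn eta = j.
Proof. by case: eta => e /= /and3P[_ _ /eqP]. Qed.

Lemma intpart_sorted : sorted geq eta.
Proof. by case: eta => e /= /and3P[]. Qed.

Lemma intpart_pos : 0%N \notin (eta : seq nat).
Proof. by case: eta => e /= /and3P[]. Qed.

Lemma up_sorted n : sorted geq (up n eta).
Proof.
rewrite (sorted_pairwise geq_trans) pairwise_cat -!(sorted_pairwise geq_trans).
rewrite intpart_sorted /=; apply/andP; split; last first.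
  by elim: (n - _)%N => [|[|m] IHm].
apply/allrelP=> x y x_eta /nseqP[-> _] /=; rewrite lt0n.
by apply: contraNneq intpart_pos => <-.
Qed.

Lemma count1_up n : count_mem 1%N (up n eta) = (count_mem 1%N eta + (n - j))%N.
Proof. by rewrite /up count_cat count_nseq intpart_sum /= mul1n. Qed.

Lemma up_succ n : (j <= n)%N -> up n.+1 eta = rcons (up n eta) 1%N.
Proof.
move=> le_jn; rewrite /up intpart_sum subSn // -cats1 -catA cats1.
by congr (_ ++ _); elim: (n - j)%N => //= m {1}->.
Qed.

(** Both sides count the permutations of type [up n.+1 eta] with a marked fixed
    point: removing the marked point leaves a permutation of type [up n eta]. *)
Lemma card_cclass_up_succ n : (j <= n)%N ->
  (n.+1 * #|cclass n (up n eta)|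
    = count_mem 1%N (up n.+1 eta) * #|cclass n.+1 (up n.+1 eta)|)%N.
Proof.
move=> le_jn; set C' := cclass n.+1 _; set c := count_mem _ _.
transitivity (\sum_(k < n.+1) #|[set s in C' | s k == k]|)%N.
  rewrite -[X in (X * _)%N]card_ord -sum_nat_const; apply: eq_bigr => k _.
  have lift_inj_k: injective (fun s : 'S_n => lift_perm k k s).
    move=> s t eq_st; apply/permP=> l; apply: (@lift_inj _ k).
    by rewrite -!(lift_perm_lift k k) eq_st.
  rewrite -(card_imset _ lift_inj_k); apply: eq_card => s.
  rewrite inE; apply/imsetP/andP=> [[t t_C ->] | [s_C /eqP sk]].
    rewrite lift_perm_id; split=> //; move: t_C; rewrite !mem_cclass ?up_sorted //.
    move=> t_C; apply: (perm_trans (cycle_type_lift k t)).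
    by rewrite up_succ // perm_sym perm_rcons perm_cons perm_sym.
  have s_lift l: exists l', s (lift k l) = lift k l'.
    case: (unliftP k (s (lift k l))) => [l' ->|]; first by exists l'.
    by move=> eq_k; case/eqP: (neq_lift k l); apply: (@perm_inj _ s); rewrite eq_k.
  pose f l := odflt l (unlift k (s (lift k l))).
  have f_lift l: lift k (f l) = s (lift k l).
    by rewrite /f; have [l' ->] := s_lift l; rewrite liftK.
  have f_inj: injective f.
    move=> l l' /(congr1 (lift k)); rewrite !f_lift => /perm_inj.
    exact: lift_inj.
  have def_s: s = lift_perm k k (perm f_inj).
    apply/permP=> y; case: (unliftP k y) => [l|] ->.
      by rewrite lift_perm_lift permE f_lift.
    by rewrite lift_perm_id.
  exists (perm f_inj) => //; move: s_C; rewrite def_s !mem_cclass ?up_sorted //.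
  have := cycle_type_lift k (perm f_inj); rewrite up_succ // perm_sym.
  move/perm_trans=> P /P; rewrite perm_sym perm_rcons perm_cons.
  by rewrite perm_sym.
transitivity (\sum_(s in C') #|[set k | s k == k]|)%N.
  have sum_b (I : finType) (P Q : pred I) :
      #|[set i | P i && Q i]| = (\sum_(i | P i) Q i)%N.
    by rewrite -sum1dep_card big_mkcondr; apply: eq_bigr => i _; case: (Q i).
  transitivity (\sum_(k < n.+1) \sum_(s in C') (s k == k))%N.
    by apply: eq_bigr => k _; apply: (sum_b _ (mem C') (fun s : 'S_n.+1 => s k == k)).
  rewrite exchange_big /=; apply: eq_bigr => s _.
  by rewrite -(sum_b _ predT (fun k => s k == k)); apply: eq_card => k; rewrite !inE.
rewrite mulnC -sum_nat_const; apply: eq_bigr => s s_C.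
rewrite -count1_cycle_type /c; move: s_C; rewrite mem_cclass ?up_sorted //.
by move/seq.permP->.
Qed.

(** The class of [up n eta] has, up to the multiplicity [up_mult n eta], the size
    that appears in [shifted_f]. Induction on [n], by comparing how both sides are
    multiplied when a fixed point is added. *)
Lemma up_mult_cclass n : (j <= n)%N ->
  ('C(n, j) * #|cclass j eta| = up_mult n eta * #|cclass n (up n eta)|)%N.
Proof.
have base: ('C(j, j) * #|cclass j eta| = up_mult j eta * #|cclass j (up j eta)|)%N.
  by rewrite /up_mult /up intpart_sum subnn cats0 !binn.
elim: n => [|n IHn]; first by rewrite leqn0 => /eqP <-.
rewrite leq_eqVlt => /predU1P[<- // | ].
rewrite ltnS => le_jn; have {IHn} := IHn le_jn.
have := card_cclass_up_succ le_jn; rewrite /up_mult !count1_up subSn //.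
set c := count_mem _ _; set A := #|_|; set A' := #|_|; set E := #|_|.
move=> eqA eqE.
apply/eqP; rewrite -(@eqn_pmul2l (n.+1 - j)) ?subn_gt0 ?ltnS //; apply/eqP.
have C1: ((n.+1 - j) * 'C(n.+1, j) = n.+1 * 'C(n, j))%N.
  by rewrite mul_bin_down.
have C2: ((n.+1 - j) * 'C((c + (n - j)).+1, c) = (c + (n - j)).+1 * 'C(c + (n - j), c))%N.
  by rewrite (_ : n.+1 - j = (c + (n - j)).+1 - c)%N ?mul_bin_down // -addnS addKn subSn.
rewrite !mulnA C1 addnS C2 -mulnA eqE mulnCA eqA addnS mulnCA.
by rewrite !mulnA.
Qed.
End Up.
End FixedPoints.

(** * Frobenius' formula *)

Section ClassSums.
Variables (gT : finGroupType) (G : {group gT}).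

(** By Schur's lemma a class sum acts on an irreducible representation as a
    scalar, which is found by evaluating the character at the identity. *)
Lemma irr_class_sum (i : Iirr G) (C : {set gT}) g :
    C \subset G -> {in C & G, forall s x, (s ^ x)%g \in C} -> g \in G ->
  \sum_(s in C) 'chi_i (s * g)%g = (\sum_(s in C) 'chi_i s) / 'chi_i 1%g * 'chi_i g.
Proof.
move=> sCG CJ Gg; pose rG := 'Chi_i; pose A := \sum_(s in C) rG s.
have Cin s : s \in C -> s \in G by move/(subsetP sCG).
have chiE x : x \in G -> 'chi_i x = \tr (rG x).
  by move=> Gx; rewrite -irrRepr cfunE Gx mulr1n.
have scalA : is_scalar_mx A.
  have absI : mx_absolutely_irreducible rG by apply/groupC/socle_irr.
  apply: (mx_abs_irr_cent_scalar absI); apply/centgmxP => x Gx.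
  rewrite /A mulmx_suml mulmx_sumr (reindex_inj (conjg_inj x^-1%g)) /=.
  apply: eq_big => s.
    apply/idP/idP=> [Cs|Cs]; last by rewrite CJ ?groupV.
    by rewrite -(conjgKV x s) CJ.
  move=> /Cin Gs; have {}Gs: s \in G by rewrite groupJr ?groupV in Gs.
  by rewrite -!repr_mxM ?groupJ ?groupV // conjgE invgK -!mulgA mulVg mulg1.
case/is_scalar_mxP: scalA => a A_a.
have trA x : x \in G -> \sum_(s in C) 'chi_i (s * x)%g = a * 'chi_i x.
  move=> Gx; rewrite chiE // -mxtraceZ -mul_scalar_mx -A_a mulmx_suml raddf_sum /=.
  by apply: eq_bigr => s /Cin Gs; rewrite chiE ?groupM // repr_mxM.
have := trA 1%g (group1 G); under eq_bigr do rewrite mulg1.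
by move=> ->; rewrite trA // mulfK ?irr1_neq0.
Qed.

End ClassSums.

Section Frobenius.
Variable n : nat.
Notation G := [set: 'S_n].
Implicit Type i : Iirr G.

(** The central character of [i]: the scalar by which the sum of the permutations
    of cycle type [mu] acts on the representation [i]. *)
Definition class_omega i (mu : seq nat) : algC :=
  (\sum_(s in cclass n mu) 'chi_i s) / 'chi_i 1%g.

Lemma sum_tuple_cons m (F : m.+1.-tuple 'S_n -> algC) (P : pred (m.+1.-tuple 'S_n)) :
  \sum_(t | P t) F t
    = \sum_s \sum_(t : m.-tuple 'S_n | P (cons_tuple s t)) F (cons_tuple s t).
Proof.
rewrite (reindex (fun p : 'S_n * m.-tuple 'S_n => cons_tuple p.1 p.2)) /=.
  by rewrite pair_big_dep.
exists (fun t => (thead t, [tuple of behead t])) => [[s t] _ | t _] /=.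
  by congr (_, _); apply/val_inj.
by apply/val_inj; case/tupleP: t.
Qed.

(** The factors are summed out one at a time with [irr_class_sum]. *)
Lemma irr_sum_factor i (ts : seq (seq nat)) g :
  \sum_(t : (size ts).-tuple 'S_n | map (@cycle_type n) t == ts)
      'chi_i ((\prod_(s <- t) s) * g)%g
    = \prod_(mu <- ts) class_omega i mu * 'chi_i g.
Proof.
elim: ts g => [|mu ts IHts] g.
  rewrite big_nil mul1r (big_pred1 [tuple]) /= => [|t]; last by rewrite !tuple0.
  by rewrite big_nil mul1g.
rewrite big_cons /= sum_tuple_cons /=.
rewrite (exchange_big_dep (fun t : (size ts).-tuple 'S_n =>
  map (@cycle_type n) t == ts)) /=; last first.
  by move=> s t _; rewrite eqseq_cons => /andP[].
rewrite -mulrA -IHts mulr_sumr; apply: eq_bigr => t t_ts.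
rewrite -irr_class_sum ?subsetT ?inE //; last by move=> s x; rewrite cclassJ.
apply: eq_big => s; first by rewrite eqseq_cons t_ts andbT inE.
by rewrite big_cons mulgA.
Qed.

(** Frobenius' formula: expand the indicator function of the identity, that is,
    the regular character, into irreducible characters. *)
Lemma num_factorE ts :
  (num_factor n ts)%:R
    = n`!%:R^-1 * \sum_(i : Iirr G)
        'chi_i 1%g ^+ 2 * \prod_(mu <- ts) class_omega i mu :> algC.
Proof.
have nf_neq0: n`!%:R != 0 :> algC by rewrite pnatr_eq0 -lt0n fact_gt0.
have card_G: #|G| = n`! by rewrite cardsT card_Sn.
apply: (mulfI nf_neq0); rewrite mulVKf // /num_factor -sum1dep_card natr_sum.
rewrite mulr_sumr.
transitivity (\sum_(t : (size ts).-tuple 'S_n | map (@cycle_type n) t == ts)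
   cfReg G (\prod_(s <- t) s)%g).
  rewrite [LHS]big_mkcond [RHS]big_mkcond; apply: eq_bigr => t _ /=.
  by rewrite cfRegE card_G andbC; case: eqP => //= _; case: eqP; rewrite ?mulr1.
rewrite cfReg_sum; under eq_bigr do rewrite sum_cfunE.
rewrite exchange_big /=; apply: eq_bigr => i _.
under eq_bigr do rewrite cfunE.
rewrite -mulr_sumr expr2 -mulrA; congr (_ * _); rewrite [RHS]mulrC -irr_sum_factor.
by apply: eq_bigr => t _; rewrite mulg1.
Qed.
End Frobenius.

(** * Common constituents of induced characters *)

Section LinearCharacters.
Variables (gT : finGroupType) (H : {group gT}).

Lemma lin_char_of_morph (f : gT -> algC) :
    f 1%g = 1 -> {in H &, forall x y, f (x * y)%g = f x * f y} ->
  exists2 phi : 'CF(H), phi \is a linear_char & {in H, phi =1 f}.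
Proof.
move=> f1 fM.
have rP: mx_repr H (fun x => (f x)%:M : 'M[algC]_1).
  by split=> [|x y Hx Hy]; rewrite ?f1 // fM // scalar_mxM.
have fE : {in H, cfRepr (MxRepresentation rP) =1 f}.
  by move=> x Hx; rewrite cfunE Hx mulr1n /= mxtrace_scalar mulr1n.
by exists (cfRepr (MxRepresentation rP)); rewrite // qualifE /= cfRepr_char fE ?f1 /=.
Qed.

(** If [theta] occurs in the restriction of ['chi_i], then its restriction to [K]
    occurs again, since what remains is a character and cannot cancel it. *)
Lemma constt_Res_lin (K G : {group gT}) (i : Iirr G) (theta : 'CF(H)) :
    H \subset G -> K \subset H -> theta \is a linear_char ->
  '['Res[H] 'chi_i, theta] != 0 -> '['Res[K] 'chi_i, 'Res[K] theta] != 0.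
Proof.
move=> sHG sKH lin_theta; have /irrP[j def_theta] := lin_char_irr lin_theta.
rewrite def_theta -irr_consttE => /constt_charP[|chi' Nchi' def_chi].
  by rewrite cfRes_char ?irr_char.
rewrite -(cfResRes _ sKH sHG) def_chi -def_theta linearD cfdotDl /=.
have lin_res: 'Res[K] theta \is a linear_char by apply: cfRes_lin_char.
have /natrP[a ->] : '['Res[K] chi', 'Res[K] theta] \is a Num.nat.
  by apply: Cnat_cfdot_char; [apply: cfRes_char | apply: lin_charW].
by have /irrP[l ->] := lin_char_irr lin_res; rewrite cfnorm_irr -mulrS pnatr_eq0.
Qed.

End LinearCharacters.

Section Stabilisers.
Variable n : nat.
Notation G := [set: 'S_n].
Implicit Types (s x c : 'S_n).

Lemma cf_sgnE (H : {group 'S_n}) s : s \in H -> cf_sgn H s = (-1) ^+ s.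
Proof. by move=> Hs; rewrite cfunE Hs. Qed.

Lemma cf_sgn_lin (H : {group 'S_n}) : cf_sgn H \is a linear_char.
Proof.
have [||phi lin_phi phiE] := @lin_char_of_morph _ H (fun s => (-1) ^+ s).
- by rewrite odd_perm1.
- by move=> x y _ _; rewrite odd_permM signr_addb.
suffices -> : cf_sgn H = phi by [].
by apply/cfun_inP=> s Hs; rewrite cf_sgnE // phiE.
Qed.

Lemma mem_stab (T : eqType) (f : 'I_n -> T) s :
  reflect (forall k, f (s k) = f k) (s \in stab_group f).
Proof. by rewrite inE; apply: (iffP forallP) => H k; apply/eqP. Qed.

Variables (T U : eqType) (f : 'I_n -> T) (g : 'I_n -> U).

(** [x] places the fibres of [f] so that none of them meets a fibre of [g]
    twice. *)
Definition transverse x := injectiveb (fun k => (f (x k), g k)).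

Lemma transverseP x :
  reflect (forall k l, f (x k) = f (x l) -> g k = g l -> k = l) (transverse x).
Proof.
apply: (iffP (injectiveP _)) => [inj k l fkl gkl | inj k l [fkl gkl]].
  by apply: inj; rewrite fkl gkl.
exact: inj.
Qed.

(** The permutations [c] that occur form a group. If [x] is transverse, it is
    trivial; if not, it contains the transposition of two points that violate
    transversality, and multiplying by it changes all signs. *)
Lemma sum_sgn_stab x :
  \sum_(c in stab_group g | (c ^ x)%g \in stab_group f) (-1) ^+ (c : bool)
    = (transverse x)%:R :> algC.
Proof.
have memD c : ((c ^ x)%g \in stab_group f) = [forall k, f (x (c k)) == f (x k)].
  apply/mem_stab/forallP=> [fc k | fc k].
    by have := fc (x k); rewrite /conjg !permM permK => ->.
  by have /eqP := fc ((x^-1)%g k); rewrite permKV /conjg !permM.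
have memg c : (c \in stab_group g) = [forall k, g (c k) == g k] by rewrite inE.
case: transverseP => [inj | ninj].
  rewrite (big_pred1 1%g) => [|c]; first by rewrite odd_perm1.
  apply/andP/eqP=> [[/mem_stab gc fc] | ->]; last by rewrite conj1g !group1.
  apply/permP=> k; rewrite perm1; apply: inj; last exact: gc.
  by move: fc; rewrite memD => /forallP/(_ k)/eqP.
have [k [l [fkl gkl neq_kl]]] : exists k l, [/\ f (x k) = f (x l), g k = g l & k != l].
  case: (pickP (fun kl : 'I_n * 'I_n => [&& f (x kl.1) == f (x kl.2),
      g kl.1 == g kl.2 & kl.1 != kl.2])) => [[k l] /and3P[/= /eqP ? /eqP ? ?] | none].
    by exists k, l.
  case: ninj => k l fkl gkl; apply/eqP; have := none (k, l).
  by rewrite /= fkl gkl !eqxx => /negbFE.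
pose t := tperm k l.
have ft y : f (x (t y)) = f (x y) by rewrite /t; case: tpermP => // ->.
have gt y : g (t y) = g y by rewrite /t; case: tpermP => // ->.
set S := \sum_(c in _ | _) _; apply/eqP; rewrite -[_ == _](@mulrn_eq0 _ S 2) mulr2n.
rewrite {1}/S (reindex_inj (mulgI t)) /=.
rewrite (eq_bigl (fun c => (c \in stab_group g) && ((c ^ x)%g \in stab_group f))).
  rewrite -big_split /= big1 // => c _.
  by rewrite odd_permM odd_tperm neq_kl /= signrN addNr.
move=> c; rewrite !memD !memg; congr (_ && _).
  apply/forallP/forallP=> gc y; last by rewrite permM (eqP (gc _)) gt.
  by have := gc (t y); rewrite permM /t tpermK -/t gt.
apply/forallP/forallP=> fc y; last by rewrite permM (eqP (fc _)) ft.
by have := fc (t y); rewrite permM /t tpermK -/t ft.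
Qed.

Notation indt := ('Ind[G, stab_group f] 1).
Notation inds := ('Ind[G, stab_group g] (cf_sgn _)).

(** Frobenius reciprocity and the formula for an induced character reduce the
    scalar product to the sums of signs of [sum_sgn_stab]. *)
Lemma cfdot_Ind_stab :
  '[inds, indt] = #|transverse|%:R / (#|stab_group f| * #|stab_group g|)%:R.
Proof.
rewrite -Frobenius_reciprocity cfdotE.
transitivity (#|stab_group g|%:R^-1 * \sum_(c in stab_group g)
   \sum_x (#|stab_group f|%:R^-1 * ((-1) ^+ (c : bool) *+ ((c ^ x)%g \in stab_group f))) : algC).
  congr (_ * _); apply: eq_bigr => c gc.
  rewrite cf_sgnE // cfResE ?subsetT // cfIndE ?subsetT //.
  rewrite rmorphM /= fmorphV rmorph_nat rmorph_sum mulrCA -mulr_sumr; congr (_ * _).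
  rewrite mulr_sumr; apply: eq_big => [x|x _]; first by rewrite inE.
  by rewrite cfun1E rmorph_nat mulr_natr.
rewrite exchange_big /= natrM invfM mulrA [in RHS]mulrC; congr (_ * _).
under eq_bigr do rewrite -mulr_sumr; rewrite -mulr_sumr mulrC; congr (_ * _).
rewrite -sum1_card natr_sum [RHS]big_mkcond; apply: eq_bigr => x _.
transitivity ((transverse x)%:R : algC); last first.
  by rewrite (_ : (x \in transverse) = transverse x) //; case: (transverse x).
rewrite -sum_sgn_stab [RHS]big_mkcondr; apply: eq_bigr => c _.
by case: ifP; rewrite ?mulr1n.
Qed.

(** The condition that defines [irr_sym], for the fibres of [f] and [g] in place
    of the rows and columns of a tableau. *)
Definition common_constt (i : Iirr G) :=
  (i \in irr_constt indt) && (i \in irr_constt inds).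

Let indt_char : indt \is a character.
Proof. by rewrite cfInd_char ?rpred1. Qed.

Let inds_char : inds \is a character.
Proof. by rewrite cfInd_char ?lin_charW ?cf_sgn_lin. Qed.

Lemma common_constt_transverse i : common_constt i -> exists x, transverse x.
Proof.
case/andP=> i_t i_s; case: (pickP transverse) => [x tx | none]; first by exists x.
have: '['chi_i, 'chi_i] = 0.
  apply: constt_ortho_char i_s i_t _ => //.
  by rewrite cfdot_Ind_stab (eq_card none) card0 mul0r.
by rewrite cfnorm_irr => /eqP; rewrite oner_eq0.
Qed.

Lemma transverse_common_constt x : transverse x -> exists i, common_constt i.
Proof.
move=> tx; case: (pickP common_constt) => [i ci | none]; first by exists i.
suffices: '[inds, indt] = 0.
  rewrite cfdot_Ind_stab => /eqP; rewrite mulf_eq0 invr_eq0 !pnatr_eq0.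
  have -> : #|transverse| == 0%N = false by rewrite (cardD1 x) (_ : x \in _).
  by rewrite muln_eq0 !eqn0Ngt !cardG_gt0.
rewrite cfdot_sum_irr big1 // => i _; apply/eqP; rewrite mulf_eq0 conjC_eq0.
by have := none i; rewrite /common_constt !irr_consttE; do 2!case: eqP.
Qed.

(** The hypothesis says that the fibres of [f] and [g] through [p] cover everything,
    as do the first row and the first column of a hook. A transverse [x] is then a
    permutation of the column followed by one of the row: the former, [c] below,
    follows [x] at the points that [x] sends out of the row, sends the remaining
    point of the column to the corner [p], and fixes everything else. *)
Lemma hook_transverse_sub p :
    (forall k, (f k == f p) || (g k == g p)) ->
  [set x | transverse x] \subset (stab_group g * stab_group f)%g.
Proof.
move=> hook; apply/subsetP=> x; rewrite inE => /transverseP tx.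
pose c0 k := if f (x k) != f p then x k else if g k != g p then k else p.
have c0_inj: injective c0.
  move=> k l; rewrite /c0.
  have hookf k' : g k' != g p -> f k' = f p.
    by move=> gk; have := hook k'; rewrite (negPf gk) orbF => /eqP.
  case: (boolP (f (x k) != f p)) => fk; case: (boolP (f (x l) != f p)) => fl.
  - exact: perm_inj.
  - case: ifPn => [gl eq_l | _ eq_p]; last by rewrite eq_p eqxx in fk.
    by rewrite eq_l (hookf l) ?eqxx in fk.
  - case: ifPn => [gk eq_l | _ eq_p]; last by rewrite -eq_p eqxx in fl.
    by rewrite -eq_l (hookf k) ?eqxx in fl.
  case: (boolP (g k != g p)) => gk; case: (boolP (g l != g p)) => gl //.
  - by move=> eq_k; rewrite eq_k eqxx in gk.
  - by move=> eq_l; rewrite -eq_l eqxx in gl.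
  move=> _; apply: tx; first by rewrite (eqP (negbNE fk)) (eqP (negbNE fl)).
  by rewrite (eqP (negbNE gk)) (eqP (negbNE gl)).
pose c := perm c0_inj; pose B := [set k | g k == g p].
have cB : c @: B = B.
  apply/eqP; rewrite eqEcard card_imset ?leqnn ?andbT; last exact: perm_inj.
  apply/subsetP=> _ /imsetP[k kB ->]; rewrite !inE permE /c0 in kB *.
  rewrite kB /=; case: ifPn => // fk.
  by have := hook (x k); rewrite (negPf fk).
have c_g : c \in stab_group g.
  apply/mem_stab=> k; have [kB | kNB] := boolP (k \in B).
    have: c k \in B by rewrite -cB imset_f.
    by move: kB; rewrite !inE => /eqP-> /eqP->.
  have: c k \notin B by rewrite -cB (mem_imset _ _ (@perm_inj _ c)).
  rewrite permE /c0; case: ifPn => [fk | _]; last first.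
    by move: kNB; rewrite inE => ->.
  by rewrite inE => gk; have := hook (x k); rewrite (negPf fk) (negPf gk).
apply/mulsgP; exists c (c^-1 * x)%g => //; last by rewrite mulKVg.
apply/mem_stab=> k; rewrite -{2}[k](permKV c) permM; move: (_ k) => l.
rewrite permE /c0; case: ifPn => // /negbNE/eqP fl; rewrite fl.
by case: ifPn => // gl; have := hook l; rewrite (negPf gl) orbF => /eqP->.
Qed.

(** There are at most as many transverse permutations as products of an element of
    each stabiliser, so the scalar product of the two induced characters is at
    most 1; two distinct common constituents would make it at least 2. *)
Lemma hook_common_constt_uniq p i j :
    (forall k, (f k == f p) || (g k == g p)) ->
  common_constt i -> common_constt j -> i = j.
Proof.
move=> hook ci cj; apply/eqP/contraT=> neq_ij.
have le1: '[inds, indt] <= 1.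
  rewrite cfdot_Ind_stab ler_pdivrMr ?ltr0n ?muln_gt0 ?cardG_gt0 // mul1r ler_nat.
  have := subset_leq_card (hook_transverse_sub hook); rewrite cardsE => /leq_trans; apply.
  by rewrite mulnC mul_cardG leq_pmulr // cardG_gt0.
suffices: 2%:R <= '[inds, indt] by
  move/le_trans/(_ le1); rewrite -[X in _ <= X]/(1%:R) ler_nat.
have nat_i (phi : 'CF(G)) k : phi \is a character -> '[phi, 'chi_k] \is a Num.nat.
  exact: Cnat_cfdot_char_irr.
have ge1 k: common_constt k -> 1 <= '[inds, 'chi_k] * '[indt, 'chi_k]^*.
  rewrite /common_constt !irr_consttE => /andP[].
  have /natrP[a ->] := nat_i _ k indt_char; have /natrP[b ->] := nat_i _ k inds_char.
  by rewrite rmorph_nat -natrM !pnatr_eq0 ler1n muln_gt0 !lt0n => -> ->.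
rewrite cfdot_sum_irr (bigD1 i) //= (bigD1 j) 1?eq_sym //= addrA -[2%:R]addr0.
apply: lerD; first by apply: lerD; apply: ge1.
apply: sumr_ge0 => k _.
have /natrP[a ->] := nat_i _ k indt_char; have /natrP[b ->] := nat_i _ k inds_char.
by rewrite rmorph_nat -natrM ler0n.
Qed.

End Stabilisers.

(** * Orbit weights of subsets *)

Section OrbitWeights.
Variable n : nat.
Notation G := [set: 'S_n].
Implicit Types (s x c : 'S_n) (J X : {set 'I_n}).

(** For [J] stable under [s], this is up to the sign [(-1) ^+ #|J|] the signature
    of the restriction of [s] to [J] (see [orbit_weight_sign]). *)
Definition orbit_weight s J : algC :=
  (s \in 'N(J | 'P))%g%:R * (-1) ^+ #|[set X in porbits s | X \subset J]|.

Definition toggle X J := [set k | (k \in J) (+) (k \in X)].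

Lemma toggleK X : involutive (toggle X).
Proof. by move=> J; apply/setP=> k; rewrite !inE -addbA addbb addbF. Qed.

Lemma mem_normP s J :
  reflect (forall k, (s k \in J) = (k \in J)) (s \in 'N(J | 'P))%g.
Proof. by apply: (iffP astabsP). Qed.

Lemma porbit_closed s k l : (s l \in porbit s k) = (l \in porbit s k).
Proof.
rewrite -!eq_porbit_mem; congr (_ == _).
by have:= porbit_perm s 1 l; rewrite expg1.
Qed.

Lemma porbit_sub s J k : (s \in 'N(J | 'P))%g -> (porbit s k \subset J) = (k \in J).
Proof.
move/mem_normP => sJ; apply/subsetP/idP=> [-> // | kJ]; first exact: porbit_id.
move=> _ /porbitP[i ->]; elim: i => [|i IHi]; first by rewrite perm1.
by rewrite expgSr permM sJ.
Qed.

Lemma orbit_weight_toggle s J k :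
  orbit_weight s (toggle (porbit s k) J) = - orbit_weight s J.
Proof.
set X0 := porbit s k; rewrite /orbit_weight.
have -> : (s \in 'N(toggle X0 J | 'P))%g = (s \in 'N(J | 'P))%g.
  apply/mem_normP/mem_normP=> sJ l; last by rewrite !inE sJ porbit_closed.
  by have := sJ l; rewrite !inE porbit_closed => /addIb.
case sJ: (s \in _); last by rewrite !mul0r oppr0.
have sT : (s \in 'N(toggle X0 J | 'P))%g.
  by apply/mem_normP=> l; rewrite !inE porbit_closed; move/mem_normP: sJ => ->.
rewrite -mulrN; congr (_ * _).
rewrite (cardsD1 X0) [in RHS](cardsD1 X0) !inE imset_f //= !porbit_sub //.
rewrite inE porbit_id addbT.
have -> : [set X in porbits s | X \subset toggle X0 J] :\ X0
        = [set X in porbits s | X \subset J] :\ X0.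
  apply/setP=> X; rewrite !inE; case: eqP => //= neqX.
  case: imsetP => //= -[l _ def_X]; rewrite def_X in neqX *.
  rewrite !porbit_sub // inE -eq_porbit_mem.
  by case: eqP => // _; rewrite addbF.
by case: (k \in J); rewrite /= ?add0n add1n exprS mulN1r ?opprK.
Qed.

(** Toggling the orbit of [k] is an involution that changes the sign of every
    term. *)
Lemma sum_orbit_weight_toggle s k (P : pred {set 'I_n}) :
  (forall J, P (toggle (porbit s k) J) = P J) -> \sum_(J | P J) orbit_weight s J = 0.
Proof.
move=> PT; set S := \sum_(J | _) _; apply/eqP.
rewrite -[_ == _](@mulrn_eq0 _ S 2) mulr2n {1}/S.
rewrite (reindex_inj (inv_inj (toggleK (porbit s k)))) /= (eq_bigl P) //.
by rewrite -big_split big1 //= => J _; rewrite orbit_weight_toggle addNr.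
Qed.

Lemma mem_full_cycle s k : (s \in cclass n [:: n]) = (porbit s k == setT).
Proof.
rewrite mem_cclass //; apply/idP/eqP=> [st | sk].
  have: #|porbits s| = 1%N.
    by have := perm_size st; rewrite size_sort size_map -cardE.
  move/eqP/cards1P=> [Y defY]; apply/setP=> l; rewrite inE.
  have: porbit s l \in porbits s by apply: imset_f.
  have: porbit s k \in porbits s by apply: imset_f.
  by rewrite defY !inE => /eqP<-; rewrite eq_porbit_mem.
have -> : [:: n] = cycle_type s => [|//].
rewrite /cycle_type (_ : porbits s = [set setT]).
  by rewrite /image_mem enum_set1 /= cardsT card_ord.
apply/setP=> X; rewrite inE; apply/imsetP/eqP=> [[l _ ->] | ->]; last by exists k.
by rewrite -sk; apply/eqP; rewrite eq_porbit_mem sk inE.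
Qed.

Lemma sum_orbit_weight s (k : 'I_n) : \sum_J orbit_weight s J = 0.
Proof. exact: (@sum_orbit_weight_toggle s k). Qed.

(** If [s] is not a full cycle, some orbit avoids [k] and can be toggled. If it is
    one, the empty set is the only stable set that avoids [k]. *)
Lemma sum_orbit_weight_avoid s k :
  \sum_(J : {set 'I_n} | k \notin J) orbit_weight s J = (s \in cclass n [:: n])%:R.
Proof.
rewrite (mem_full_cycle s k); case: eqP => [sk | /eqP].
  rewrite (bigD1 set0) ?inE //= big1 ?addr0 => [|J /andP[kJ J0]].
    rewrite /orbit_weight (_ : (s \in _)%g) ?mul1r; last first.
      by apply/mem_normP=> l; rewrite !inE.
    rewrite (_ : [set X in _ | _] = set0) ?cards0 ?expr0 //.
    apply/setP=> X; rewrite !inE subset0; apply/andP=> -[/imsetP[l _ ->] /eqP /setP].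
    by move/(_ l); rewrite porbit_id inE.
  rewrite /orbit_weight; case sJ: (s \in _)%g; last by rewrite mul0r.
  have /set0Pn[l lJ] := J0.
  by move: kJ; rewrite -(porbit_sub l sJ) in lJ; rewrite (subsetP lJ) // 
    -eq_porbit_mem eq_sym eq_porbit_mem sk inE.
rewrite -subTset => /subsetPn[l _ l_k].
apply: (@sum_orbit_weight_toggle s l) => J.
by rewrite inE -eq_porbit_mem eq_sym eq_porbit_mem (negPf l_k) addbF.
Qed.

Lemma orbit_weightJ s x J : orbit_weight (s ^ x)%g (x @: J) = orbit_weight s J.
Proof.
have memx k (A : {set 'I_n}): (x k \in x @: A) = (k \in A).
  by rewrite mem_imset //; apply: perm_inj.
rewrite /orbit_weight; congr ((nat_of_bool _)%:R * _).
  apply/mem_normP/mem_normP=> sJ k.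
    by have := sJ (x k); rewrite /conjg !permM permK !memx.
  by rewrite -[k](permKV x) /conjg !permM permK !memx sJ.
have inj_im: injective (fun X => x @: X) by apply: imset_inj; apply: perm_inj.
rewrite -[in RHS](card_imset _ inj_im); congr (_ ^+ _); apply: eq_card => Y.
rewrite inE porbits_conj; apply/andP/imsetP=> [[/imsetP[X Xs ->] XJ] | [X]].
  exists X => //; rewrite inE Xs; apply/subsetP=> k kX.
  by rewrite -memx (subsetP XJ) // memx.
by rewrite inE => /andP[Xs XJ] ->; rewrite imset_f ?imsetS.
Qed.

Lemma perm_set_card J J' : #|J| = #|J'| -> exists x, x @: J = J'.
Proof.
move=> eqJ; pose L (A : {set 'I_n}) := enum A ++ enum (~: A).
have L_uniq A : uniq (L A).
  rewrite cat_uniq !enum_uniq /= andbT; apply/hasPn=> k.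
  by rewrite !mem_enum inE.
have L_mem A k : k \in L A by rewrite mem_cat !mem_enum inE orbN.
have L_size A : size (L A) = n.
  by rewrite size_cat -!cardE cardsC card_ord.
pose f k := nth k (L J') (index k (L J)).
have lt_i k : (index k (L J) < n)%N by rewrite -[X in (_ < X)%N](L_size J) index_mem.
have f_inj: injective f.
  move=> k l; rewrite /f (set_nth_default k l) ?L_size // => /eqP.
  rewrite nth_uniq ?L_size // => /eqP /(congr1 (nth k (L J))).
  by rewrite !nth_index.
exists (perm f_inj); apply/eqP.
rewrite eqEcard card_imset ?eqJ ?leqnn ?andbT; last exact: perm_inj.
apply/subsetP=> _ /imsetP[k kJ ->].
have kE: k \in enum J by rewrite mem_enum.
have lt_k: (index k (enum J) < size (enum J'))%N by rewrite -cardE -eqJ cardE index_mem.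
by rewrite permE /f /L index_cat kE nth_cat lt_k -mem_enum mem_nth.
Qed.

Section Irreducible.
Variable i : Iirr G.

(** Up to a nonzero factor, the multiplicity of ['chi_i] in the character induced
    from the stabiliser of [J], trivial on the permutations of the complement of
    [J] and the sign on those of [J]. *)
Definition orbit_mult J := \sum_s orbit_weight s J * 'chi_i s.

Lemma orbit_mult_card J J' : #|J| = #|J'| -> orbit_mult J = orbit_mult J'.
Proof.
case/perm_set_card=> x <-; rewrite /orbit_mult [RHS](reindex_inj (conjg_inj x)) /=.
by apply: eq_bigr => s _; rewrite orbit_weightJ cfunJ ?inE.
Qed.

(** The sum of the weights of the sets that avoid a point detects full cycles, so
    some [orbit_mult i J] does not vanish. As the sum over all subsets does vanish
    and [orbit_mult i] depends only on the size, another size occurs as well. *)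
Lemma orbit_mult_pair : (0 < n)%N -> class_omega i [:: n] != 0 ->
  exists J J' : {set 'I_n}, [/\ #|J| != #|J'|, orbit_mult J != 0 & orbit_mult J' != 0].
Proof.
case: (posnP n) => // n_gt0 _; pose k := Ordinal n_gt0 => omega_neq0.
have sum1: \sum_(J : {set 'I_n} | k \notin J) orbit_mult J != 0.
  rewrite exchange_big /=; under eq_bigr do rewrite -mulr_suml sum_orbit_weight_avoid.
  move: omega_neq0; rewrite /class_omega mulf_eq0 negb_or => /andP[+ _].
  rewrite big_mkcond; congr (_ != 0); apply: eq_bigr => s _.
  by case: (s \in _); rewrite ?mul1r ?mul0r.
have [J J_neq0]: exists J, orbit_mult J != 0.
  apply/existsP; apply: contraNT sum1 => /existsPn none.
  by rewrite big1 // => J _; apply/eqP; rewrite -[_ == _]negbK none.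
suffices [J' neqJ J'_neq0]: exists2 J' : {set 'I_n}, #|J| != #|J'| & orbit_mult J' != 0.
  by exists J, J'.
apply/exists_inP; apply/contraT => /exists_inPn none.
have: \sum_A orbit_mult A = 0.
  rewrite exchange_big big1 //= => s _; rewrite -mulr_suml (sum_orbit_weight s k).
  by rewrite mul0r.
rewrite (bigID (fun A : {set 'I_n} => #|J| == #|A|)) /=.
rewrite [X in _ + X]big1 => [|A /none /negPn/eqP //]; rewrite addr0.
under eq_bigr => A /eqP/orbit_mult_card <- do [].
rewrite sumr_const => /eqP; rewrite mulrn_eq0 (negPf J_neq0) orbF.
by move=> /eqP/card0_eq/(_ J); rewrite unfold_in (introT eqnP (erefl _)).
Qed.

End Irreducible.
End OrbitWeights.

(** * Constituents detected by orbit weights *)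

Section HookConstituents.
Variable n : nat.
Notation G := [set: 'S_n].
Implicit Types (s x c : 'S_n) (J X : {set 'I_n}).

(** The permutations that preserve [pin J] are those that fix [J] pointwise; this
    presents the symmetric group of the complement of [J] as the stabiliser of a
    function, like the row and column stabilisers. *)
Definition pin J (k : 'I_n) := if k \in J then Some k else None.

Lemma pinP J s :
  reflect ((forall k, (s k \in J) = (k \in J)) /\ {in J, forall k, s k = k})
          (s \in stab_group (pin J)).
Proof.
apply: (iffP (mem_stab _ _)) => [sJ | [sJ fixJ] k]; last first.
  by rewrite /pin sJ; case: ifP => // kJ; rewrite fixJ.
have sJ1 k : (s k \in J) = (k \in J).
  by have := sJ k; rewrite /pin; case: ifP; case: ifP.
split=> // k kJ; have := sJ k; rewrite /pin sJ1 kJ; by case.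
Qed.

Lemma porbit_restr s J k : (s \in 'N(J | 'P))%g -> k \in J ->
  porbit (restr_perm J s) k = porbit s k.
Proof.
move=> sJ kJ; have E i: (restr_perm J s ^+ i)%g k = (s ^+ i)%g k.
  elim: i => [|i IHi]; first by rewrite !perm1.
  rewrite !expgSr !permM IHi restr_permE //.
  by apply: (subsetP _ _ (mem_porbit s i k)); rewrite porbit_sub.
by apply/setP=> l; apply/porbitP/porbitP=> -[i ->]; exists i.
Qed.

Lemma porbit_restr_out s J k : k \notin J -> porbit (restr_perm J s) k = [set k].
Proof.
move=> kJ; apply/setP=> l; rewrite inE; apply/porbitP/eqP=> [[i ->] | ->]; last first.
  by exists 0%N; rewrite perm1.
elim: i => [|i IHi]; first by rewrite perm1.
by rewrite expgSr permM IHi (out_perm (restr_perm_on J s)).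
Qed.

(** The orbits of [restr_perm J s] are those of [s] in [J] and the points outside
    [J]; the parity of their number gives the signature. *)
Lemma orbit_weight_sign s J : (s \in 'N(J | 'P))%g ->
  orbit_weight s J = (-1) ^+ #|J| * (-1) ^+ (restr_perm J s : bool).
Proof.
move=> sJ; rewrite /orbit_weight sJ mul1r /odd_perm card_ord.
set A := [set X in porbits s | _].
have -> : porbits (restr_perm J s) = A :|: [set [set k] | k in ~: J].
  apply/setP=> X; rewrite inE; apply/imsetP/orP=> [[k _ ->] | ].
    have [kJ | kJ] := boolP (k \in J).
      by left; rewrite porbit_restr // inE imset_f // porbit_sub.
    by right; rewrite porbit_restr_out // imset_f // inE.
  case=> [|/imsetP[k]]; last first.
    by rewrite inE => kJ ->; exists k; rewrite ?porbit_restr_out.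
  rewrite inE => /andP[/imsetP[k _ ->]]; rewrite porbit_sub // => kJ.
  by exists k; rewrite ?porbit_restr.
have -> : #|A :|: [set [set k] | k in ~: J]| = (#|A| + #|~: J|)%N.
  rewrite cardsU (_ : _ :&: _ = set0) ?cards0 ?subn0 ?card_imset //.
    exact: set1_inj.
  apply/setP=> X; rewrite !inE; apply/negP=> /andP[/andP[_ XJ] /imsetP[k kJ def_X]].
  by move: kJ; rewrite inE (subsetP XJ) // def_X set11.
have eq_n : n = (#|J| + #|~: J|)%N by rewrite cardsC card_ord.
rewrite [X in odd X (+) _]eq_n !oddD -signr_odd -[in RHS]signr_odd -signr_addb.
congr (_ ^+ (nat_of_bool _)).
by case: (odd #|A|); case: (odd #|J|); case: (odd #|~: J|).
Qed.

(** [theta], the signature of the restriction to [J], is a linear character of the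
    stabiliser of [J] that occurs in ['chi_i]. It is trivial on the permutations
    that fix [J] pointwise, and the sign on those that fix the complement. *)
Lemma orbit_mult_constt (i : Iirr G) J : orbit_mult i J != 0 ->
  (i \in irr_constt ('Ind[G, stab_group (pin J)] 1))
  && (i \in irr_constt ('Ind[G, stab_group (pin (~: J))] (cf_sgn _))).
Proof.
move=> mJ; pose Y := 'N(J | 'P)%G.
have [||theta lin_theta thetaE] :=
  @lin_char_of_morph _ Y (fun s => (-1) ^+ (restr_perm J s : bool)).
- by rewrite morph1 odd_perm1.
- by move=> s t Ys Yt; rewrite morphM // odd_permM signr_addb.
have theta_neq0 : '['Res[Y] 'chi_i, theta] != 0.
  apply: contraNneq mJ => /eqP; rewrite cfdotE mulf_eq0 invr_eq0 pnatr_eq0.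
  rewrite eqn0Ngt cardG_gt0 /= => /eqP sum0; apply/eqP.
  rewrite /orbit_mult (bigID (mem Y)) /= [X in _ + X]big1 ?addr0; last first.
    by move=> s /negPf NYs; rewrite /orbit_weight NYs !mul0r.
  rewrite -[RHS](mulr0 ((-1) ^+ #|J|)) -[in RHS]sum0 mulr_sumr.
  apply: eq_bigr => s Ys.
  rewrite orbit_weight_sign // cfResE ?subsetT // thetaE //.
  by rewrite rmorph_sign -mulrA [_ * 'chi_i s]mulrC.
have sub1 : stab_group (pin J) \subset Y.
  by apply/subsetP=> s /pinP[sJ _]; apply/mem_normP.
have sub2 : stab_group (pin (~: J)) \subset Y.
  apply/subsetP=> s /pinP[sJ _]; apply/mem_normP=> k.
  by apply: negb_inj; have := sJ k; rewrite !inE.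
have res1 : 'Res[stab_group (pin J)] theta = 1.
  apply/cfun_inP=> s s_pin; rewrite cfResE // thetaE ?(subsetP sub1) // cfun1E s_pin.
  suffices ->: restr_perm J s = 1%g by rewrite odd_perm1.
  have /pinP[_ fixJ] := s_pin.
  apply/permP=> k; rewrite perm1; have [kJ | kJ] := boolP (k \in J).
    by rewrite restr_permE ?(subsetP sub1) ?fixJ.
  by rewrite (out_perm (restr_perm_on J s)).
have res2 : 'Res[stab_group (pin (~: J))] theta = cf_sgn _.
  apply/cfun_inP=> s s_pin; rewrite cfResE // thetaE ?(subsetP sub2) // cf_sgnE //.
  congr (_ ^+ (odd_perm _)); have /pinP[_ fixJ] := s_pin.
  apply/permP=> k; have [kJ | kJ] := boolP (k \in J).
    by rewrite restr_permE ?(subsetP sub2).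
  by rewrite (out_perm (restr_perm_on J s)) ?fixJ ?inE.
have constt_ind (H : {group 'S_n}) (phi : 'CF(H)) :
    '['Res[H] 'chi_i, phi] != 0 -> i \in irr_constt ('Ind[G] phi).
  by rewrite irr_consttE cfdotC conjC_eq0 Frobenius_reciprocity.
apply/andP; split; apply: constt_ind; rewrite -?res1 -?res2.
  exact: (constt_Res_lin (subsetT _) sub1 lin_theta).
exact: (constt_Res_lin (subsetT _) sub2 lin_theta).
Qed.

Lemma transverse_pin_inj (U : eqType) (g : 'I_n -> U) J x :
  transverse (pin J) g x -> {in x @^-1: (~: J) &, injective g}.
Proof.
move/transverseP=> tx k l; rewrite !inE => /negPf kJ /negPf lJ; apply: tx.
by rewrite /pin kJ lJ.
Qed.

Lemma card_preim_perm x J : #|x @^-1: J| = #|J|.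
Proof.
rewrite -(card_imset _ (@perm_inj _ x)); apply: eq_card => k.
apply/imsetP/idP=> [[l] | kJ]; first by rewrite inE => lJ ->.
by exists ((x^-1)%g k); rewrite ?inE permKV.
Qed.

Lemma card_inj_bound (A : {set 'I_n}) (g : 'I_n -> nat) b :
  {in A &, injective g} -> (forall k, g k < b)%N -> (#|A| <= b)%N.
Proof.
case: b => [|b] inj_g lt_gb.
  by rewrite leqn0 cards_eq0; apply/eqP/setP=> k; have := lt_gb k.
rewrite -(card_ord b.+1) -(@card_in_imset _ _ (fun k => inord (g k) : 'I_b.+1) A).
  exact: max_card.
move=> k l kA lA /(congr1 val) /=; rewrite !inordK ?lt_gb //; exact: inj_g.
Qed.

(** Translating the complement of [J] so that it meets [J'] in at most one point
    requires that their sizes add up to at most [n + 1]. *)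
Lemma pin_pin_card (i : Iirr G) J J' :
  common_constt (pin J) (pin (~: J')) i -> (#|J'| <= #|J|.+1)%N.
Proof.
case/common_constt_transverse => x /transverse_pin_inj.
set A := x @^-1: _ => injA.
have AJ' : (#|A :&: J'| <= 1)%N.
  apply/card_le1_eqP=> k l; rewrite !in_setI => /andP[kA kJ] /andP[lA lJ].
  by apply: injA => //; rewrite /pin !inE kJ lJ.
have : (#|A :|: J'| <= n)%N by have := max_card (A :|: J'); rewrite card_ord.
have cJ : (#|J| + #|~: J| = n)%N by rewrite cardsC card_ord.
have cA : #|A| = #|~: J| by rewrite card_preim_perm.
have := cardsUI A J'; rewrite cA; move: AJ' cJ.
move: #|_ :&: _| #|_ :|: _| #|~: J| #|J| #|J'| => a b p q r a1 qp_n ba b_n.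
have : (p + r <= n + 1)%N by rewrite -ba leq_add.
by rewrite -qp_n [(q + p)%N]addnC -addnA leq_add2l addn1.
Qed.

End HookConstituents.

(** * Characters that do not vanish at a full cycle *)

Lemma common_constt_ext n (T U T' U' : eqType) (f : 'I_n -> T) (g : 'I_n -> U)
    (f' : 'I_n -> T') (g' : 'I_n -> U') i :
    (forall k l, f k = f l <-> f' k = f' l) ->
    (forall k l, g k = g l <-> g' k = g' l) ->
  common_constt f g i -> common_constt f' g' i.
Proof.
have stab_ext (V V' : eqType) (h : 'I_n -> V) (h' : 'I_n -> V') :
    (forall k l, h k = h l <-> h' k = h' l) -> stab_group h = stab_group h'.
  move=> eq_h; apply/val_inj/setP=> s.
  by apply/mem_stab/mem_stab=> sh k; apply/eq_h/sh.
by move=> /stab_ext ef /stab_ext eg; rewrite /common_constt ef eg.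
Qed.

Section HookPartitions.
Variable n : nat.
Notation G := [set: 'S_n].
Implicit Types (la : intpart n) (i : Iirr G).

Notation row la := (fun k : 'I_n => reshape_index la k).
Notation col la := (fun k : 'I_n => reshape_offset la k).

(** A row and a column meet in at most one cell, so that the identity is
    transverse and the choice made by [irr_sym] never falls back on its default. *)
Lemma irr_symP la :
  exists2 i, irr_sym la = 'chi_i & common_constt (row la) (col la) i.
Proof.
rewrite /irr_sym; case: pickP => [i ci | none]; first by exists i.
have: transverse (row la) (col la) 1%g.
  apply/transverseP=> k l; rewrite !perm1 => eq_row eq_col; apply/val_inj => /=.
  by rewrite -[LHS](reshape_indexK la) eq_row eq_col reshape_indexK.
by case/transverse_common_constt=> i ci; have := none i; rewrite [_ && _]ci.
Qed.

(** Of the two sizes given by [orbit_mult_pair], the larger one exceeds the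
    smaller by at most 1 according to [pin_pin_card]. *)
Lemma full_cycle_constt i : (0 < n)%N -> class_omega i [:: n] != 0 ->
  exists2 b, (b < n)%N &
    (exists J J' : {set 'I_n},
       [/\ #|J| = b, #|J'| = b.+1, orbit_mult i J != 0 & orbit_mult i J' != 0]).
Proof.
move=> n_gt0 /(orbit_mult_pair n_gt0)[J [J' []]].
wlog ltJ: J J' / (#|J| < #|J'|)%N => [IH | _ mJ mJ'].
  rewrite neq_ltn => /orP[lt | lt] mJ mJ'.
    by apply: (IH _ _ lt); rewrite // neq_ltn lt.
  by apply: (IH _ _ lt); rewrite // neq_ltn lt.
have /andP[cJ _] := orbit_mult_constt mJ; have /andP[_ cJ'] := orbit_mult_constt mJ'.
have le_J: (#|J'| <= #|J|.+1)%N by apply: (@pin_pin_card _ i); apply/andP.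
exists #|J|; last by exists J, J'; split=> //; apply/eqP; rewrite eqn_leq le_J.
by have := max_card J'; rewrite card_ord; apply: leq_trans.
Qed.

Lemma nseq1P (e : seq nat) :
  0%N \notin e -> (sumn e <= size e)%N -> e = nseq (size e) 1%N.
Proof.
elim: e => //= a e IHe; rewrite inE negb_or => /andP[a0 e0] le_e.
have {}a0 : (0 < a)%N by case: (a) a0.
have le_s := size_sumn_pos e0.
have a1 : a = 1%N.
  apply/eqP; rewrite eqn_leq a0 andbT -(leq_add2r (size e)).
  by apply: leq_trans le_e; rewrite leq_add2l.
by rewrite a1 add1n ltnS in le_e *; rewrite -IHe.
Qed.

(** The first row and the first column already account for [n] cells. *)
Lemma intpart_hook la b : (b < n)%N ->
  (n - b <= nth 0 la 0)%N -> (b < size la)%N -> parts la = (n - b)%N :: nseq b 1%N.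
Proof.
move=> lt_bn; have := intpart_sum la; have := intpart_pos la.
case: (parts la) => [|a e] //=; rewrite inE negb_or => /andP[_ e0] sum_e le_a.
rewrite ltnS => le_b; have le_e := size_sumn_pos e0.
have le_sb : (sumn e <= b)%N.
  by rewrite -(leq_add2l (n - b)) subnK ?(ltnW lt_bn) // -{2}sum_e leq_add2r.
have eq_b : size e = b by apply/eqP; rewrite eqn_leq le_b (leq_trans le_e).
rewrite -eq_b -nseq1P ?eq_b //; congr (_ :: _).
have eq_s : sumn e = b by apply/eqP; rewrite eqn_leq le_sb -{1}eq_b.
by rewrite -sum_e eq_s addnK.
Qed.

(** With [b] from [full_cycle_constt], a set of size [n - b] meets every column of
    [la] at most once and a set of size [b + 1] meets every row at most once, which
    bounds the number of columns and of rows from below. *)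
Lemma irr_sym_full_cycle la i : (0 < n)%N -> irr_sym la = 'chi_i ->
    class_omega i [:: n] != 0 ->
  exists2 b, (b < n)%N & parts la = (n - b)%N :: nseq b 1%N.
Proof.
move=> n_gt0 la_i omega_i; have [j la_j cj] := irr_symP la.
have {la_i la_j}eq_ij : j = i by apply: irr_inj; rewrite -la_j.
rewrite {j}eq_ij in cj; have /andP[c_row c_col] := cj.
have [b lt_bn [J [J' [cardJ cardJ' mJ mJ']]]] := full_cycle_constt n_gt0 omega_i.
have /andP[cJ _] := orbit_mult_constt mJ; have /andP[_ cJ'] := orbit_mult_constt mJ'.
have lt_sum (k : 'I_n) : (k < sumn la)%N by rewrite intpart_sum.
exists b => //; apply: intpart_hook => //.
  have : common_constt (pin J) (col la) i by apply/andP.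
  case/common_constt_transverse=> x /transverse_pin_inj /card_inj_bound.
  rewrite card_preim_perm cardsCs setCK cardJ card_ord; apply=> k.
  apply: leq_trans (reshape_offsetP (lt_sum k)) _.
  have := intpart_sorted la; rewrite sorted_pairwise; last exact: geq_trans.
  move/(pairwiseP 0%N) => la_dec; case r: (reshape_index la k) => [|r'] //.
  have lt_r : (r'.+1 < size la)%N by rewrite -r reshape_indexP.
  by apply: la_dec; rewrite ?inE // (leq_trans _ lt_r).
have : common_constt (row la) (pin (~: J')) i by apply/andP.
case/common_constt_transverse=> x /transverseP tx.
rewrite -cardJ'; apply: (@card_inj_bound _ _ (fun k => reshape_index la (x k))).
  move=> k l kJ lJ eq_kl; apply: tx => //.
  by rewrite /pin !inE kJ lJ.
by move=> k; rewrite reshape_indexP.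
Qed.

Section Hook.
Variable b : nat.
Hypothesis lt_bn : (b < n)%N.

Definition hook_shape := (n - b)%N :: nseq b 1%N.

Lemma hook_is_part : is_part n hook_shape.
Proof.
apply/and3P; split.
- rewrite /=; have: (0 < n - b)%N by rewrite subn_gt0.
  by elim: b (n - b)%N => //= c IHc m m_gt0; rewrite m_gt0 IHc.
- rewrite inE negb_or eq_sym -lt0n subn_gt0 lt_bn /=.
  by apply/negP=> /nseqP[].
by rewrite /= sumn_nseq mul1n subnK // ltnW.
Qed.

Definition hook_part : intpart n := IntPart hook_is_part.

Lemma hook_row (k : nat) : (k < n)%N -> 
  reshape_index hook_shape k = if (k < n - b)%N then 0%N else (k - (n - b)).+1.
Proof.
move=> lt_kn; case: ltnP => [lt_k | le_k].
  have := @flatten_indexKl hook_shape 0 k lt_k.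
  by rewrite /flatten_index /= add0n.
have lt_r : (k - (n - b) < b)%N by rewrite ltn_subLR // subnK // ltnW.
have := @flatten_indexKl hook_shape (k - (n - b)).+1 0.
rewrite /= nth_nseq lt_r => /(_ isT).
rewrite /flatten_index /= take_nseq ?(ltnW lt_r) // sumn_nseq mul1n addn0.
by rewrite subnKC.
Qed.

Lemma hook_col (k : nat) : (k < n)%N -> 
  reshape_offset hook_shape k = if (k < n - b)%N then k else 0%N.
Proof.
move=> lt_kn; case: ltnP => [lt_k | le_k].
  have := @flatten_indexKr hook_shape 0 k lt_k.
  by rewrite /flatten_index /= add0n.
have lt_r : (k - (n - b) < b)%N by rewrite ltn_subLR // subnK // ltnW.
have := @flatten_indexKr hook_shape (k - (n - b)).+1 0.
rewrite /= nth_nseq lt_r => /(_ isT).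
rewrite /flatten_index /= take_nseq ?(ltnW lt_r) // sumn_nseq mul1n addn0.
by rewrite subnKC.
Qed.

Let J : {set 'I_n} := [set k : 'I_n | (n - b <= k)%N].

Lemma card_hook_leg : #|J| = b.
Proof.
have : #|~: J| = (n - b)%N.
  have le_n : (n - b <= n)%N by rewrite leq_subr.
  have inj_w : injective (widen_ord le_n).
    by move=> k l /(congr1 val) eq_kl; apply/val_inj.
  rewrite -[RHS]card_ord -(card_imset _ inj_w); apply: eq_card => k.
  rewrite !inE -ltnNge; apply/idP/imsetP=> [lt_k | [l _ ->]]; last exact: (ltn_ord l).
  by exists (Ordinal lt_k) => //; apply/val_inj.
move=> cardC; have := cardsC J; rewrite cardC card_ord => eq_n.
by apply/eqP; rewrite -(eqn_add2r (n - b)) eq_n subnKC // ltnW.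
Qed.

(** Up to relabelling of the fibres, the rows of the hook are those of [pin J],
    where [J] is the set of cells below the first row, and its columns are those
    of [pin] for the complement of the first column. So ['chi_i] is a common
    constituent for the hook, and there is only one. *)
Lemma irr_sym_hook i :
    (exists J1 J2 : {set 'I_n},
       [/\ #|J1| = b, #|J2| = b.+1, orbit_mult i J1 != 0 & orbit_mult i J2 != 0]) ->
  irr_sym hook_part = 'chi_i.
Proof.
move=> [J1 [J2 [cJ1 cJ2 mJ1 mJ2]]].
have n_gt0 : (0 < n)%N by apply: leq_ltn_trans lt_bn.
pose p : 'I_n := Ordinal n_gt0.
have rowE (k : 'I_n) : reshape_index hook_part k
    = if (k < n - b)%N then 0%N else (k - (n - b)).+1 by apply: hook_row.
have colE (k : 'I_n) : reshape_offset hook_part k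
    = if (k < n - b)%N then val k else 0%N by apply: hook_col.
have pJ : p \notin J by rewrite inE -ltnNge subn_gt0.
have cardJ' : #|p |: J| = b.+1 by rewrite cardsU1 pJ card_hook_leg.
rewrite (orbit_mult_card _ (etrans cJ1 (esym card_hook_leg))) in mJ1.
rewrite (orbit_mult_card _ (etrans cJ2 (esym cardJ'))) in mJ2.
have /andP[c1 _] := orbit_mult_constt mJ1; have /andP[_ c2] := orbit_mult_constt mJ2.
have ci : common_constt (row hook_part) (col hook_part) i.
  apply: (@common_constt_ext _ _ _ _ _ (pin J) (pin (~: (p |: J)))); last by apply/andP.
    move=> k l; rewrite !rowE /pin !inE !(leqNgt (n - b)).
    case: ltnP => le_k; case: ltnP => le_l //=; split=> // -[].
      by move=> ->.
    move=> eq_kl; congr Some; apply/val_inj => /=.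
    by rewrite -(subnK le_k) -(subnK le_l) eq_kl.
  move=> k l; rewrite !colE /pin !inE !(leqNgt (n - b)) -!val_eqE /=.
  case: ltnP => le_k; case: ltnP => le_l /=; rewrite ?orbT ?orbF //=.
  - have [->|k0] := eqVneq (val k) 0%N; have [->|l0] := eqVneq (val l) 0%N => //=.
    + by split=> // eq_kl; case/eqP: l0.
    + by split=> // eq_kl; case/eqP: k0.
    by split=> [[->] | eq_kl] //; congr Some; apply/val_inj.
  - have [-> // | k0] := eqVneq (val k) 0%N; split=> //= eq_k.
    by case/eqP: k0.
  have [-> // | l0] := eqVneq (val l) 0%N; split=> //= eq_l.
  by case/eqP: l0.
rewrite /irr_sym; case: pickP => [j cj | /(_ i)]; last by rewrite [_ && _]ci.
congr 'chi_ _.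
apply: (@hook_common_constt_uniq _ _ _ (row hook_part) (col hook_part) p) => // k.
have p_lt : (p < n - b)%N by rewrite /= subn_gt0.
rewrite !rowE !colE p_lt.
by case: ltnP => //= _; rewrite eqxx ?orbT.
Qed.

End Hook.

Lemma full_cycle_irr_sym i : (0 < n)%N -> class_omega i [:: n] != 0 ->
  exists b, exists2 la : intpart n, parts la = (n - b)%N :: nseq b 1%N
    & (b < n)%N /\ irr_sym la = 'chi_i.
Proof.
move=> n_gt0 omega_i; have [b lt_bn exJ] := full_cycle_constt n_gt0 omega_i.
by exists b, (hook_part lt_bn) => //; split=> //; apply: irr_sym_hook.
Qed.

End HookPartitions.

(** * Linear relations *)

(** The first row contributes the first power minus that of [- 1 + 2^-1], and the
    rows of length 1 telescope from the latter to the second power. *)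
Lemma shifted_p_hook a b k :
  shifted_p k (a :: nseq b 1%N)
    = (a%:R - 1 + 2^-1) ^+ k - (- b.+1%:R + 2^-1) ^+ k.
Proof.
rewrite /shifted_p /= size_nseq big_ord_recl /=.
pose u j : algC := (- j.+1%:R + 2^-1) ^+ k.
rewrite (eq_bigr (fun j : 'I_b => - (u j.+1 - u j))) => [|j _]; last first.
  rewrite opprB /u /= nth_nseq ltn_ord; congr (_ ^+ k - _).
  by rewrite -[j.+2]add1n natrD opprD addrA subrr add0r.
rewrite sumrN -(big_mkord xpredT (fun j => u j.+1 - u j)) telescope_sumr //.
by rewrite opprB addrA subrK.
Qed.

Lemma rho_meval K (x y : algC) :
  (rho K).@[fun i => if i == 0 then x else y] = \prod_(k <- K) (x ^+ k - y ^+ k).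
Proof.
rewrite /rho rmorph_prod; apply: eq_bigr => k _.
by rewrite rmorphB !rmorphXn /= !mevalXU.
Qed.

Section Linearity.
Variables (d' : nat) (K : seq nat) (a : nat -> algC).

(** The conclusion of the theorem for a quantity [F] that depends on [K]; naming
    it lets the sums and factors of the definitions be stripped off one by one. *)
Definition theta_linear (F : seq nat -> algC) :=
  F K = \sum_(1 <= i < d'.+1) a i * F (theta i d').

Lemma eq_theta_linear F F' : F =1 F' -> theta_linear F' -> theta_linear F.
Proof.
by move=> eqF; rewrite /theta_linear eqF => ->; apply: eq_bigr => i _; rewrite eqF.
Qed.

Lemma theta_linear_sum (I : finType) (P : pred I) (F : I -> seq nat -> algC) :
  (forall i, P i -> theta_linear (F i)) -> theta_linear (fun L => \sum_(i | P i) F i L).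
Proof.
move=> linF; rewrite /theta_linear (eq_bigr _ linF) exchange_big /=.
by apply: eq_bigr => j _; rewrite mulr_sumr.
Qed.

Lemma theta_linearZ (c : algC) (F : seq nat -> algC) :
  (c != 0 -> theta_linear F) -> theta_linear (fun L => c * F L).
Proof.
rewrite /theta_linear; have [-> _ | _ -> //] := eqVneq c 0.
  by rewrite mul0r big1 // => i _; rewrite mul0r mulr0.
by rewrite mulr_sumr; apply: eq_bigr => i _; rewrite mulrCA.
Qed.

(** The product over [L] is the value of [rho L] at [(x, y)], and evaluation is
    linear. *)
Lemma theta_linear_prod (S : nat -> algC) :
    0%N \notin K -> rho K = \sum_(1 <= i < d'.+1) a i *: rho (theta i d') ->
    (exists x y, forall k, (0 < k)%N -> S k = x ^+ k - y ^+ k) ->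
  theta_linear (fun L => \prod_(k <- L) S k).
Proof.
move=> K_pos aP [x [y S_xy]].
have prodS L : 0%N \notin L -> 
    \prod_(k <- L) S k = (rho L).@[fun i => if i == 0 then x else y].
  move=> L_pos; rewrite rho_meval; apply: eq_big_seq => k kL.
  by apply: S_xy; rewrite lt0n; apply: contraNneq L_pos => <-.
rewrite /theta_linear prodS // aP raddf_sum /= big_nat [RHS]big_nat.
apply: eq_bigr => i /andP[i_gt0 _]; rewrite mevalZ prodS // /theta inE negb_or.
by rewrite eq_sym -lt0n i_gt0; apply/negP=> /nseqP[].
Qed.

End Linearity.

Section Degree.
Variables (d : nat).
Hypothesis d_gt0 : (0 < d)%N.
Notation G := [set: 'S_d].

Lemma class_omegaE (i : Iirr G) mu :
  class_omega i mu = #|cclass d mu|%:R * 'chi_i (repr (cclass d mu)) / 'chi_i 1%g.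
Proof.
rewrite /class_omega (eq_bigr (fun _ => 'chi_i (repr (cclass d mu)))) => [|s s_mu].
  by rewrite sumr_const mulr_natl.
have /cycle_type_conj[x ->] : cycle_type s = cycle_type (repr (cclass d mu)).
  have := mem_repr s s_mu; move: s_mu.
  by rewrite !inE => /eqP-> /eqP->.
by rewrite cfunJ ?inE.
Qed.

Lemma class_omega_irr_sym (i : Iirr G) (la : intpart d) mu :
  irr_sym la = 'chi_i ->
  class_omega i mu = #|cclass d mu|%:R * irr_val la mu / irr_dim la.
Proof. by move=> la_i; rewrite class_omegaE /irr_val /irr_dim la_i. Qed.

Lemma shifted_p_hook_part (la : intpart d) b : parts la = (d - b)%N :: nseq b 1%N ->
  exists x y, forall k, (0 < k)%N -> shifted_p k la = x ^+ k - y ^+ k.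
Proof.
move=> ->; exists ((d - b)%:R - 1 + 2^-1), (- b.+1%:R + 2^-1) => k _.
exact: shifted_p_hook.
Qed.

Lemma prod_fact_neq0 (ks : seq nat) : \prod_(k <- ks) k`!%:R != 0 :> algC.
Proof.
by rewrite prodf_seq_neq0; apply/allP=> k _ /=; rewrite pnatr_eq0 -lt0n fact_gt0.
Qed.

Lemma W_tildeE m K (beta : seq nat) :
  W_tilde d m K beta = (d`!%:R * m`!%:R)^-1 * \sum_(la : intpart d)
     c_coef la m * ((\prod_(mu <- [:: [:: d]; beta]) (#|cclass d mu|%:R * irr_val la mu))
        / irr_dim la ^ (2%:Z - 1)) * \prod_(k <- K) shifted_p k la.
Proof.
rewrite /W_tilde /Wdm -mulrA; congr (_ * _); rewrite mulr_suml.
apply: eq_bigr => la _; rewrite -[LHS]mulrA; congr (_ * _).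
by rewrite prodf_div divfK // prod_fact_neq0.
Qed.

Section Completed.
Variable kappa : nat -> forall j, intpart j -> algC.

(** The scalar by which the completed cycle of order [k] acts on the
    representation [i]. *)
Definition completed_omega (i : Iirr G) k : algC :=
  \sum_(eta : {j : 'I_d.+1 & intpart j})
     kappa k (tagged eta) * (up_mult d (tagged eta))%:R
       * class_omega i (up d (tagged eta)).

(** After Frobenius' formula, the sum over the tuples [eta] factors into one sum for
    each entry of [ks]. *)
Lemma Hd_E ks mus :
  Hd kappa d ks mus * \prod_(k <- ks) k`!%:R
    = d`!%:R^-1 * (d`!%:R^-1 * \sum_(i : Iirr G)
        'chi_i 1%g ^+ 2 * \prod_(mu <- mus) class_omega i mu
         * \prod_(k <- ks) completed_omega i k).
Proof.
rewrite /Hd -mulrA; congr (_ * _).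
under [X in X * _ = _]eq_bigr => eta _ do rewrite num_factorE mulrCA mulr_sumr.
rewrite -mulr_sumr -mulrA; congr (_ * _); rewrite exchange_big mulr_suml /=.
apply: eq_bigr => i _.
transitivity ('chi_i 1%g ^+ 2 * \prod_(mu <- mus) class_omega i mu *
  ((\sum_(eta : {ffun 'I_(size ks) -> {j : 'I_d.+1 & intpart j}}) \prod_(l < size ks)
    (kappa (nth 0%N ks l) (tagged (eta l)) * (up_mult d (tagged (eta l)))%:R
      * class_omega i (up d (tagged (eta l))) / (nth 0%N ks l)`!%:R))
   * \prod_(k <- ks) k`!%:R)).
  rewrite mulrA; congr (_ * _); rewrite mulr_sumr; apply: eq_bigr => eta _.
  have swap (x y z t : algC) : x * (y * (z * t)) = y * t * (x * z).
    by rewrite mulrCA -!mulrA; congr (_ * _); rewrite [RHS]mulrC mulrA.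
  rewrite big_cat big_map big_enum /= swap; congr (_ * _); rewrite -big_split /=.
  apply: eq_bigr => l _.
  by rewrite -!mulrA; congr (_ * _); rewrite mulrC -!mulrA.
congr (_ * _).
rewrite -(bigA_distr_bigA (fun (l : 'I_(size ks)) (eta : {j : 'I_d.+1 & intpart j}) =>
   kappa (nth 0%N ks l) (tagged eta) * (up_mult d (tagged eta))%:R
      * class_omega i (up d (tagged eta)) / (nth 0%N ks l)`!%:R)).
rewrite [X in _ * X](big_nth 0%N) big_mkord [RHS](big_nth 0%N) big_mkord -big_split /=.
by apply: eq_bigr => l _; rewrite -mulr_suml divfK // pnatr_eq0 -lt0n fact_gt0.
Qed.

Lemma sum_ord_widen (F : nat -> algC) p q :
    (forall j, (p < j)%N -> F j = 0) -> (forall j, (q < j)%N -> F j = 0) ->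
  \sum_(j < p.+1) F j = \sum_(j < q.+1) F j.
Proof.
wlog le_pq : p q / (p <= q)%N => [IH Fp Fq | Fp _].
  by case: (leqP p q) => [/IH-> // | /ltnW/IH->].
rewrite -!(big_mkord xpredT F) [RHS](@big_cat_nat _ _ _ p.+1) //=.
by rewrite [X in _ + X]big_nat [X in _ + X]big1 ?addr0 // => j /andP[/Fp].
Qed.

Hypothesis kappaP : shifted_coords kappa.

(** By [up_mult_cclass] each [eta] contributes [kappa k eta * shifted_f eta la]. The
    two ranges of summation differ only in vanishing terms: [shifted_f] is 0 for
    [j > d], and [kappa k] is 0 for [j > N]. *)
Lemma completed_omegaE (i : Iirr G) (la : intpart d) k :
  irr_sym la = 'chi_i -> (0 < k)%N -> completed_omega i k = shifted_p k la.
Proof.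
move=> la_i k_gt0; have [N [kappa0 ->]] := kappaP k_gt0; rewrite /completed_omega.
pose F j := \sum_(eta : intpart j) kappa k eta * shifted_f eta la.
transitivity (\sum_(j < d.+1) F j); last first.
  apply: sum_ord_widen => j lt_j; rewrite /F big1 // => eta _.
    by rewrite /shifted_f bin_small // !mul0r mulr0.
  by rewrite kappa0 // mul0r.
rewrite /F (sig_big_dep (fun=> true) (fun=> xpredT)
  (fun (j : 'I_d.+1) (eta : intpart j) => kappa k eta * shifted_f eta la)) /=.
apply: eq_bigr => -[[j lt_j] eta] _ /=; have le_j : (j <= d)%N by [].
rewrite -mulrA (class_omega_irr_sym _ la_i) /shifted_f; congr (_ * _).
by rewrite !mulrA -!natrM up_mult_cclass.
Qed.

Lemma full_cycle_completed_omega (i : Iirr G) : class_omega i [:: d] != 0 ->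
  exists x y, forall k, (0 < k)%N -> completed_omega i k = x ^+ k - y ^+ k.
Proof.
case/(full_cycle_irr_sym d_gt0) => b [la def_la [_ la_i]].
have [x [y p_xy]] := shifted_p_hook_part def_la; exists x, y => k k_gt0.
by rewrite (completed_omegaE la_i) ?p_xy.
Qed.

End Completed.

Lemma full_cycle_shifted_p (la : intpart d) :
    #|cclass d [:: d]|%:R * irr_val la [:: d] != 0 ->
  exists x y, forall k, (0 < k)%N -> shifted_p k la = x ^+ k - y ^+ k.
Proof.
have [i la_i _] := irr_symP la => nz.
have [|b _ def_la] := irr_sym_full_cycle d_gt0 la_i.
  2: exact: shifted_p_hook_part def_la.
by rewrite (class_omega_irr_sym _ la_i) mulf_neq0 // /irr_dim la_i invr_eq0 irr1_neq0.
Qed.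

End Degree.

Theorem theorem5p3
  (kappa : nat -> forall j : nat, intpart j -> algC)
  (kappaP : shifted_coords kappa)
  (d m d' : nat) (d_gt0 : (0 < d)%N) (m_bounds : (1 <= m <= d)%N)
  (d'_gt0 : (0 < d')%N)
  (beta : intpart d) (K : intpart d')
  (a : nat -> algC)
  (aP : rho K = \sum_(1 <= i < d'.+1) a i *: rho (theta i d')) :
  W_tilde d m K beta
    = \sum_(1 <= i < d'.+1) a i * W_tilde d m (theta i d') beta
  /\
  H_tilde kappa d m K beta
    = \sum_(1 <= i < d'.+1) a i * H_tilde kappa d m (theta i d') beta.
Proof.
have K_pos := intpart_pos K; split.
  suffices: theta_linear d' K a (fun L => W_tilde d m L beta) by [].
  apply: eq_theta_linear (fun L => W_tildeE d m L beta) _.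
  apply: theta_linearZ => _; apply: theta_linear_sum => la _.
  apply: theta_linearZ => nz; apply: theta_linear_prod => //.
  apply: full_cycle_shifted_p => //; apply: contraNneq nz.
  by rewrite big_cons => ->; rewrite !mul0r mulr0.
suffices: theta_linear d' K a (fun L => H_tilde kappa d m L beta) by [].
apply: (@eq_theta_linear _ _ _ _ (fun L => \sum_(mu : intpart d | size mu == m)
    Hd kappa d L [:: [:: d]; beta : seq nat; mu : seq nat] * \prod_(k <- L) k`!%:R)).
  by move=> L; rewrite /H_tilde /Hdm mulr_suml.
apply: theta_linear_sum => mu _; apply: eq_theta_linear => [L|].
  exact: Hd_E.
apply: theta_linearZ => _; apply: theta_linearZ => _; apply: theta_linear_sum => i _.
apply: theta_linearZ => nz; apply: theta_linear_prod => //.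
apply: full_cycle_completed_omega => //; apply: contraNneq nz.
by rewrite /= big_cons => ->; rewrite mul0r mulr0.
Qed.
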